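(* Consider instances of the two-machine flow shop problem $F2\,||\,C_{\max}$ with $n$ jobs, indexed $1,\dots,n$ according to Johnson's sequence, with $A=\{1,\dots,n_A\}$ and $B=\{n_A+1,\dots,n\}$ nonempty, such that $$P_{1A}\le P_{2A}-p^{\max}_{A1}\qquad\text{and}\qquad P_{2B}\le P_{1B}-p^{\max}_{B2}.$$ Let $k_A\in\{1,\dots,n_A\}$ be the smallest index in $A$ such that $$\sum_{i\in A:\ p_{1,i}\le p_{1,k_A}} p_{1,i}\ \le\ \sum_{i\in A:\ p_{1,i}\le p_{1,k_A}} p_{2,i}-p^{\max}_{A1}\quad\text{and}\quad p_{1,k_A}<p_{1,k_A+1}$$ (the second condition being regarded as satisfied if $k_A=n_A$), and let $k_B\in\{n_A+1,\dots,n\}$ be the largest index in $B$ such that $$\sum_{i\in B:\ p_{2,i}\le p_{2,k_B}} p_{2,i}\ \le\ \sum_{i\in B:\ p_{2,i}\le p_{2,k_B}} p_{1,i}-p^{\max}_{B2}\quad\text{and}\quad p_{2,k_B}<p_{2,k_B-1}$$ (the second condition being regarded as satisfied if $k_B=n_A+1$). If $k_A\log k_A\le n$ and $(n-k_B+1)\log(n-k_B+1)\le n$, then an optimal solution to $F2\,||\,C_{\max}$ can be computed in linear time $O(n)$, and only jobs $1,\dots,k_A$ need to be sorted within $A$ and only jobs $k_B,\dots,n$ need to be sorted within $B$; that is, every sequence consisting of jobs $1,\dots,k_A$ in this order, then jobs $k_A+1,\dots,n_A$ in any order, then jobs $n_A+1,\dots,k_B-1$ in any order, then jobs $k_B,\dots,n$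 in this order, is optimal.
   Context: Two-machine flow shop $F2\,||\,C_{\max}$: a finite set of $n$ jobs must be processed first on machine $M_1$ and then on machine $M_2$; job $j$ requires processing time $p_{1,j}\ge 0$ on $M_1$ and $p_{2,j}\ge 0$ on $M_2$. All jobs are available at time $0$, each machine processes at most one job at a time, preemption is not allowed, and a job can start on $M_2$ only after completing on $M_1$. The goal is to minimize the makespan $C_{\max}$, i.e. the latest completion time on $M_2$. A sequence (permutation) of the jobs defines the permutation schedule in which both machines process the jobs in that order, each operation starting as early as possible. A sequence is optimal if the makespan of its schedule is minimum among all feasible schedules (it is well known that some permutation schedule attains this minimum). Johnson's sequence: $A$ is the set of jobs with $p_{1,j}\le p_{2,j}$ and $B$ the set of jobs with $p_{1,j}>p_{2,j}$; first come the jobs of $A$ in nondecreasing order of $p_{1,j}$, then the jobs of $B$ in nonincreasing order of $p_{2,j}$ (ties broken arbitrarily). Jobs are indexed so that Johnson's sequence is $1,2,\dots,n$, with $A=\{1,\dots,n_A\}$ and $B=\{n_A+1,\dots,n\}$. This indexing is only for notation: the input of an algorithm is the list of pairs $(p_{1,j},p_{2,j})$ in arbitrary (unsorted) order. Running time counts arithmetic operations and comparisons on processing times at unit cost; $\log$ is to a fixed base greater than $1$ (e.g. base $2$). ''Computed in linear time'' means that there is one algorithm and one constant $c$ such that on every instance satisfying the hypotheses it outputs an optimal sequence after at most $c\,n$ operations. Notation: $P_{1A}=\sum_{i\in A}p_{1,i}$, $P_{2A}=\sum_{i\in A}p_{2,i}$, $P_{1B}=\sum_{i\in B}p_{1,i}$,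 $P_{2B}=\sum_{i\in B}p_{2,i}$, $p^{\max}_{A1}=\max_{i\in A}p_{1,i}$, $p^{\max}_{B2}=\max_{i\in B}p_{2,i}$. *)

(* Defs.v *)
From HB Require Import structures.
From mathcomp Require Import all_boot all_order all_algebra all_fingroup.
From mathcomp Require Import reals exp.

Set Implicit Arguments.
Unset Strict Implicit.
Unset Printing Implicit Defensive.

Import Order.TTheory GRing.Theory Num.Theory.
Local Open Scope ring_scope.

(** * Two-machine flow shop *)

Section FlowShop.
Context {R : realFieldType} {n : nat}.
Implicit Types (p : 'I_n -> R) (s : seq 'I_n).

(* Without preemption a schedule is determined by the starting times. *)
Record schedule := Schedule { start1 : 'I_n -> R; start2 : 'I_n -> R }.

Definition no_overlap (start p : 'I_n -> R) : Prop :=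
  forall i j, i != j -> start i + p i <= start j \/ start j + p j <= start i.

Definition feasible p1 p2 (S : schedule) : Prop :=
  [/\ forall j, 0 <= start1 S j,
      no_overlap (start1 S) p1,
      no_overlap (start2 S) p2 &
      forall j, start1 S j + p1 j <= start2 S j].

Definition makespan p2 (S : schedule) : R :=
  \big[Num.max/0]_(j < n) (start2 S j + p2 j).

(* Times at which M1 and M2 become free once the jobs of [s] have been
   processed in this order, each operation starting as early as possible. *)
Definition release p1 p2 s : R * R :=
  foldl (fun c j => (c.1 + p1 j, Num.max (c.1 + p1 j) c.2 + p2 j)) (0, 0) s.

Definition perm_schedule p1 p2 s : schedule :=
  let before j := release p1 p2 (take (index j s) s) in
  Schedule (fun j => (before j).1)
           (fun j => Num.max ((before j).1 + p1 j) (before j).2).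

Definition optimal_sequence p1 p2 s : Prop :=
  [/\ perm_eq s (enum 'I_n),
      feasible p1 p2 (perm_schedule p1 p2 s) &
      forall S, feasible p1 p2 S ->
        makespan p2 (perm_schedule p1 p2 s) <= makespan p2 S].

Definition jobsA p1 p2 : {set 'I_n} := [set j | p1 j <= p2 j].
Definition jobsB p1 p2 : {set 'I_n} := [set j | p2 j < p1 j].

Definition johnson_sequence p1 p2 s : Prop :=
  exists sA sB : seq 'I_n,
    [/\ s = sA ++ sB,
        perm_eq sA (enum (jobsA p1 p2)),
        perm_eq sB (enum (jobsB p1 p2)),
        sorted (fun i j => p1 i <= p1 j) sA &
        sorted (fun i j => p2 j <= p2 i) sB].

(* The jobs are indexed according to Johnson's sequence; job [j] of the
   mathematical numbering 1, ..., n is the ordinal of value [j - 1]. *)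
Definition johnson_indexed p1 p2 : Prop := johnson_sequence p1 p2 (enum 'I_n).

(* Used for nonnegative [f] only, so that the default value 0 is harmless. *)
Definition pmax (X : {set 'I_n}) (f : 'I_n -> R) : R :=
  \big[Num.max/0]_(i in X) f i.

(* The inequality defining k_A is the case X = A, f = p1, g = p2; the one
   defining k_B is the case X = B, f = p2, g = p1. *)
Definition gap_at (X : {set 'I_n}) (f g : 'I_n -> R) (k : 'I_n) : Prop :=
  \sum_(i in X | f i <= f k) f i <=
  \sum_(i in X | f i <= f k) g i - pmax X f.

(* The strict inequality with the next (resp. previous) job is only required
   when that job belongs to A (resp. B). *)
Definition kA_condition p1 p2 (k : 'I_n) : Prop :=
  [/\ k \in jobsA p1 p2,
      gap_at (jobsA p1 p2) p1 p2 k &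
      forall j : 'I_n, j \in jobsA p1 p2 -> j = k.+1 :> nat -> p1 k < p1 j].

Definition kB_condition p1 p2 (k : 'I_n) : Prop :=
  [/\ k \in jobsB p1 p2,
      gap_at (jobsB p1 p2) p2 p1 k &
      forall j : 'I_n, j \in jobsB p1 p2 -> k = j.+1 :> nat -> p2 k < p2 j].

Definition is_kA p1 p2 (k : 'I_n) : Prop :=
  kA_condition p1 p2 k /\ forall k', kA_condition p1 p2 k' -> (k <= k')%N.

Definition is_kB p1 p2 (k : 'I_n) : Prop :=
  kB_condition p1 p2 k /\ forall k', kB_condition p1 p2 k' -> (k' <= k)%N.

End FlowShop.

Definition logb {R : realType} (b x : R) : R := ln x / ln b.

(** * Algorithms: a structured unit-cost real RAM

   A program is a finite syntax tree, independent of the instance and of its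
   size.  The memory consists of integer arrays and of value arrays, each array
   being named by a constant of the program.  Values (the processing times and
   what is computed from them) can only be combined by field operations and
   compared; they cannot be turned into integers. *)

Inductive iexpr :=
  | IConst of nat
  | ILoad of nat & iexpr
  | IAdd of iexpr & iexpr
  | ISub of iexpr & iexpr
  | IHalf of iexpr.

Inductive vexpr :=
  | VLoad of nat & iexpr
  | VAdd of vexpr & vexpr
  | VSub of vexpr & vexpr
  | VMul of vexpr & vexpr
  | VDiv of vexpr & vexpr.

Inductive test :=
  | TILe of iexpr & iexpr
  | TVLe of vexpr & vexpr
  | TNot of test
  | TAnd of test & test.

(* [CIStore a i e] writes [e] in cell [i] of the integer array [a]. *)
Inductive program :=
  | CSkip
  | CIStore of nat & iexpr & iexpr
  | CVStore of nat & iexpr & vexpr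
  | CSeq of program & program
  | CIf of test & program & program
  | CWhile of test & program.

(* Every node of an expression is one operation. *)
Fixpoint icost (e : iexpr) : nat :=
  match e with
  | IConst _ => 1
  | ILoad _ e1 => (icost e1).+1
  | IAdd e1 e2 | ISub e1 e2 => (icost e1 + icost e2).+1
  | IHalf e1 => (icost e1).+1
  end.

Fixpoint vcost (e : vexpr) : nat :=
  match e with
  | VLoad _ e1 => (icost e1).+1
  | VAdd e1 e2 | VSub e1 e2 | VMul e1 e2 | VDiv e1 e2 =>
      (vcost e1 + vcost e2).+1
  end.

Fixpoint tcost (t : test) : nat :=
  match t with
  | TILe e1 e2 => (icost e1 + icost e2).+1
  | TVLe e1 e2 => (vcost e1 + vcost e2).+1
  | TNot t1 => (tcost t1).+1
  | TAnd t1 t2 => (tcost t1 + tcost t2).+1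
  end.

Section Semantics.
Context {R : realFieldType}.

Record memory := Memory {
  imem : nat -> nat -> nat;
  vmem : nat -> nat -> R }.

Implicit Type m : memory.

Definition upd {T : Type} (f : nat -> nat -> T) (a i : nat) (x : T) :=
  fun a' i' => if (a' == a) && (i' == i) then x else f a' i'.

Fixpoint ieval m (e : iexpr) : nat :=
  match e with
  | IConst k => k
  | ILoad a e1 => imem m a (ieval m e1)
  | IAdd e1 e2 => (ieval m e1 + ieval m e2)%N
  | ISub e1 e2 => (ieval m e1 - ieval m e2)%N
  | IHalf e1 => (ieval m e1)./2
  end.

Fixpoint veval m (e : vexpr) : R :=
  match e with
  | VLoad a e1 => vmem m a (ieval m e1)
  | VAdd e1 e2 => veval m e1 + veval m e2
  | VSub e1 e2 => veval m e1 - veval m e2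
  | VMul e1 e2 => veval m e1 * veval m e2
  | VDiv e1 e2 => veval m e1 / veval m e2
  end.

Fixpoint teval m (t : test) : bool :=
  match t with
  | TILe e1 e2 => (ieval m e1 <= ieval m e2)%N
  | TVLe e1 e2 => veval m e1 <= veval m e2
  | TNot t1 => ~~ teval m t1
  | TAnd t1 t2 => teval m t1 && teval m t2
  end.

(* [exec P m t m']: started in memory [m], the program [P] halts in memory
   [m'] after [t] operations. *)
Inductive exec : program -> memory -> nat -> memory -> Prop :=
  | ExecSkip m : exec CSkip m 1 m
  | ExecIStore m a i e :
      exec (CIStore a i e) m (icost i + icost e).+1
        (Memory (upd (imem m) a (ieval m i) (ieval m e)) (vmem m))
  | ExecVStore m a i e :
      exec (CVStore a i e) m (icost i + vcost e).+1
        (Memory (imem m) (upd (vmem m) a (ieval m i) (veval m e)))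
  | ExecSeq m m' m'' P Q t t' :
      exec P m t m' -> exec Q m' t' m'' -> exec (CSeq P Q) m (t + t').+1 m''
  | ExecIfTrue m m' b P Q t :
      teval m b -> exec P m t m' -> exec (CIf b P Q) m (tcost b + t).+1 m'
  | ExecIfFalse m m' b P Q t :
      ~~ teval m b -> exec Q m t m' -> exec (CIf b P Q) m (tcost b + t).+1 m'
  | ExecWhileTrue m m' m'' b P t t' :
      teval m b -> exec P m t m' -> exec (CWhile b P) m' t' m'' ->
      exec (CWhile b P) m (tcost b + t + t').+1 m''
  | ExecWhileFalse m b P :
      ~~ teval m b -> exec (CWhile b P) m (tcost b).+1 m.

(* Input: [n] in cell 0 of integer array 0, p1 in value array 0, p2 in value
   array 1; everything else is 0. *)
Definition input_memory n (p1 p2 : 'I_n -> R) : memory :=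
  let value (p : 'I_n -> R) i := if insub i is Some j then p j else 0 in
  Memory (fun a i => if (a == 0%N) && (i == 0%N) then n else 0%N)
         (fun a i => if a == 0%N then value p1 i
                     else if a == 1%N then value p2 i else 0).

(* Output: the first [n] cells of integer array 1. *)
Definition output n (m : memory) : seq nat := [seq imem m 1 i | i <- iota 0 n].

(* Within [T] operations, [P] halts and outputs an optimal sequence. *)
Definition solves_within (P : program) n (p1 p2 : 'I_n -> R) (T : nat) : Prop :=
  exists (t : nat) (m : memory) (s : seq 'I_n),
    [/\ exec P (input_memory p1 p2) t m, (t <= T)%N,
        output n m = [seq val j | j <- s] &
        optimal_sequence p1 p2 s].

End Semantics.

(* Main.v *)
Require Import Defs.
From HB Require Import structures.
From mathcomp Require Import all_boot all_order all_algebra all_fingroup.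
From mathcomp Require Import reals exp.
From mathcomp Require Import zify ring lra.
Set Implicit Arguments.
Unset Strict Implicit.
Unset Printing Implicit Defensive.
Import Order.TTheory GRing.Theory Num.Theory.
Local Open Scope ring_scope.

(** The makespan of a permutation schedule is reached along a critical job k:
    it is the load of M1 up to and including k plus the load of M2 from k on
    ([release2_le]).  Call surplus of a set of A-jobs the sum of p2 - p1 over
    it.

    If k is an unsorted job of A, the jobs sorted before it have a surplus of
    at least p1 k, and those between have a nonnegative surplus; so the path
    through k is no longer than the total load of M2, which every schedule must
    process.  If k belongs to the sorted prefix, its path length is a lower
    bound for every schedule ([feasible_bound]): among the jobs other than those
    before k and those of B with p1 < p1 k, look at the first one to leave M1.
    Its operation on M1, what M1 processes before it and what M2 processes after
    it already account for that length.  Reversing time exchanges A with B and M1 with M2, which settles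
    the jobs of B.  This is [partly_sorted_optimal]; it only asks of the sorted
    parts that they consist of smallest jobs and have a large enough surplus.

    The algorithm therefore extracts the jobs of A by increasing p1, and those
    of B by increasing p2, until the surplus extracted reaches the largest key
    of the class.  A tournament tree is built in linear time and yields each
    extraction in O(log n) steps.  The jobs 1, ..., k_A have strictly smaller
    keys than the rest of A, so as long as at most k_A jobs are extracted they
    are among these ([smallest_sub]), and the loop stops after at most k_A
    rounds; likewise for B.  The time spent on A is O(n + k_A log n), and this is
    linear when k_A log k_A <= n ([mul_log_linear]): if k_A <= sqrt n, because
    log n = O(sqrt n); otherwise because log n < 2 log k_A.

    The cost of programs is tracked by timed Hoare triples ([runs]). *)

(** * Optimality of partly sorted sequences *)

Variant cat_split_spec {T : Type} (l w x : seq T) k y : Prop :=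
  | SplitLeft y' of l = x ++ k :: y' & y = y' ++ w
  | SplitRight x' of x = l ++ x' & w = x' ++ k :: y.

Lemma cat_splitP {T : Type} (l w x : seq T) k y :
  l ++ w = x ++ k :: y -> cat_split_spec l w x k y.
Proof.
elim: l x => [|h l IH] x; first by right with x.
case: x => [|h' x] /= [->] => [<-|/IH[y' -> ->|x' -> ->]].
- by left with l.
- by left with y'.
- by right with x'.
Qed.

Section Optimality.
Context {R : realFieldType} {n : nat}.
Implicit Types (p : 'I_n -> R) (s : seq 'I_n).

(** Splitting the jobs at an arbitrary job j into those that end before j
    starts and those that start after j ends also works for jobs of length 0,
    several of which may start at the same time. *)
Lemma disjoint_intervals_fit p (start : 'I_n -> R) (Y : {set 'I_n}) lo hi :
    no_overlap start p -> lo <= hi ->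
    {in Y, forall i, lo <= start i /\ start i + p i <= hi} ->
  \sum_(i in Y) p i <= hi - lo.
Proof.
move=> disj; have [N] := ubnP #|Y|.
elim: N Y lo hi => // N IH Y lo hi leYN lohi inY.
have [->|[j jY]] := set_0Vmem Y; first by rewrite big_set0 subr_ge0.
have [loj jhi] := inY j jY.
pose Y' := Y :\ j.
have ltY' : (#|Y'| < N)%N by have := cardsD1 j Y; rewrite jY -/Y'; lia.
pose Y1 := [set i in Y' | start i + p i <= start j].
have sub1 : Y1 \subset Y' by apply/subsetP => i; rewrite inE => /andP[].
have after : {in Y' :\: Y1, forall i, start j + p j <= start i}.
  move=> i; rewrite !inE => /andP[nbefore /andP[neq iY]].
  by case: (disj i j neq) => // before; move: nbefore; rewrite neq iY before.
rewrite (big_setD1 j) //= -/Y' (big_setID Y1) /= (setIidPr sub1).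
have le1 : \sum_(i in Y1) p i <= start j - lo.
  apply: IH => //; first by apply: leq_ltn_trans ltY'; apply: subset_leq_card.
  by move=> i; rewrite !inE => /andP[/andP[_ iY] before]; case: (inY i iY).
have le2 : \sum_(i in Y' :\: Y1) p i <= hi - (start j + p j).
  apply: IH => //.
    by apply: leq_ltn_trans ltY'; apply: subset_leq_card; apply: subsetDl.
  move=> i iD; split; first exact: after.
  by move: iD; rewrite !inE => /and3P[_ _ iY]; case: (inY i iY).
lra.
Qed.

(** Let j be the first job outside L to leave M1, at time T.  The jobs of L
    that leave M1 before j starts, and j itself, fit on M1 before T; all other
    jobs start on M2 after T.  A job of L is thus counted with p1 or with p2,
    whence the minimum. *)
Lemma feasible_bound p1 p2 S C (L : pred 'I_n) theta :
    (forall j, 0 <= p1 j) -> (forall j, 0 <= p2 j) ->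
    feasible p1 p2 S -> (forall j, start2 S j + p2 j <= C) ->
    (exists j, ~~ L j) -> (forall j, ~~ L j -> theta <= p1 j) ->
  theta + \sum_i (if L i then Num.min (p1 i) (p2 i) else p2 i) <= C.
Proof.
move=> p1_ge0 p2_ge0 [start_ge0 disj1 disj2 prec] leC [j0 j0L] theta_le.
pose c1 j := start1 S j + p1 j.
have [j jL jmin] : exists2 j, ~~ L j & forall i, ~~ L i -> c1 j <= c1 i.
  by case: (@Order.TotalTheory.arg_minP _ _ _ j0 (predC L) c1 j0L) => j ? ?;
     exists j.
pose X := [set i | L i && (c1 i <= start1 S j)].
have early : \sum_(i in X) p1 i <= start1 S j - 0.
  apply: (disjoint_intervals_fit disj1); first exact: start_ge0.
  by move=> i; rewrite inE => /andP[_ ?]; split.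
have late : \sum_(i in ~: X) p2 i <= C - c1 j.
  apply: (disjoint_intervals_fit disj2).
    apply: le_trans (leC j); apply: le_trans (prec j) _.
    by rewrite lerDl.
  move=> i; rewrite !inE => iX; split=> //.
  apply: le_trans (prec i); have [iL|/jmin//] := boolP (L i).
  have neq_ij : i != j by apply: contraNneq jL => <-.
  move: iX; rewrite iL /= -ltNge => gt_i.
  case: (disj1 i j neq_ij) => [|le_ji]; first by rewrite leNgt gt_i.
  by rewrite (le_trans le_ji) // lerDl.
rewrite (bigID (mem X)) /=.
have le1 : \sum_(i in X) (if L i then Num.min (p1 i) (p2 i) else p2 i)
           <= \sum_(i in X) p1 i.
  by apply: ler_sum => i; rewrite inE => /andP[-> _]; rewrite ge_min lexx.
have le2 : \sum_(i | i \notin X) (if L i then Num.min (p1 i) (p2 i) else p2 i)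
           <= \sum_(i in ~: X) p2 i.
  rewrite [leRHS](eq_bigl (fun i => i \notin X)); last by move=> i; rewrite inE.
  by apply: ler_sum => i _; case: ifP => _; rewrite ?ge_min ?lexx ?orbT.
have := theta_le j jL; rewrite /c1 in late; lra.
Qed.

Lemma feasible_total p1 p2 S C :
    (forall j, 0 <= p1 j) -> feasible p1 p2 S -> 0 <= C ->
    (forall j, start2 S j + p2 j <= C) ->
  \sum_i p2 i <= C.
Proof.
move=> p1_ge0 [start_ge0 _ disj2 prec] C_ge0 leC.
have := disjoint_intervals_fit (Y := setT) disj2 C_ge0.
rewrite subr0 (eq_bigl xpredT) => [|i]; last by rewrite inE.
apply=> i _; split=> //; apply: le_trans (prec i).
by rewrite addr_ge0.
Qed.

Definition reverse p1 p2 C (S : schedule) : @schedule R n :=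
  Schedule (fun j => C - (start2 S j + p2 j)) (fun j => C - (start1 S j + p1 j)).

Lemma feasible_reverse p1 p2 S C :
    feasible p1 p2 S -> (forall j, start2 S j + p2 j <= C) ->
  feasible p2 p1 (reverse p1 p2 C S) /\
  forall j, start2 (reverse p1 p2 C S) j + p1 j <= C.
Proof.
case=> start_ge0 disj1 disj2 prec leC; split=> [|j] /=; last first.
  by have := start_ge0 j; lra.
split=> /= [j|i j neq|i j neq|j].
- by have := leC j; lra.
- by case: (disj2 i j neq) => ?; [right|left]; lra.
- by case: (disj1 i j neq) => ?; [right|left]; lra.
- by have := prec j; lra.
Qed.

Definition path_length p1 p2 (x : seq 'I_n) k y : R :=
  \sum_(i <- x) p1 i + p1 k + p2 k + \sum_(i <- y) p2 i.

(** The critical job k is in A = a ++ u, whose part a is sorted; w lists B in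
    any order. *)
Lemma path_bound p1 p2 S C a u w x k y :
    (forall j, 0 <= p1 j) -> (forall j, 0 <= p2 j) ->
    feasible p1 p2 S -> 0 <= C -> (forall j, start2 S j + p2 j <= C) ->
    perm_eq (a ++ u ++ w) (enum 'I_n) ->
    {in a ++ u, forall j, p1 j <= p2 j} -> {in w, forall j, p2 j <= p1 j} ->
    pairwise (fun i j => p1 i <= p1 j) a ->
    {in a & u, forall i j, p1 i <= p1 j} ->
    {in u, forall j, \sum_(i <- a) p1 i + p1 j <= \sum_(i <- a) p2 i} ->
    a ++ u = x ++ k :: y ->
  path_length p1 p2 x k (y ++ w) <= C.
Proof.
move=> p1_ge0 p2_ge0 feas C_ge0 leC perm_s leA leB sorted_a le_au gap split_au.
have sum_s f : \sum_i f i = \sum_(i <- x) f i + f k + \sum_(i <- y ++ w) f i :> R.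
  rewrite -big_enum -(perm_big _ perm_s) catA split_au /=.
  by rewrite -catA /= big_cat big_cons /= addrA.
have le_x i : i \in x -> p1 i <= p2 i.
  by move=> ix; apply: leA; rewrite split_au mem_cat ix.
have [y' def_a def_y|x' def_x def_u] := cat_splitP split_au.
  (* k lies in the sorted part: the exceptional jobs L are those before k and
     those of w that are shorter than k on M1. *)
  pose L i := (i \in x) || (i \in w) && (p1 i < p1 k).
  have uniq_s : uniq (x ++ k :: y ++ w).
    have := enum_uniq 'I_n; rewrite -(perm_uniq perm_s) catA split_au -catA /=.
    by [].
  have kx : k \notin x.
    by move: uniq_s; rewrite cat_uniq => /and3P[_ /hasPn/(_ k (mem_head _ _))].
  have kL : ~~ L k by rewrite /L (negPf kx) ltxx andbF.
  have theta j : ~~ L j -> p1 k <= p1 j.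
    rewrite negb_or => /andP[jx]; rewrite negb_and -leNgt => /orP[jw|//].
    have : j \in x ++ k :: y ++ w.
      have := mem_enum 'I_n j; rewrite -(perm_mem perm_s) catA split_au -catA.
      by [].
    rewrite mem_cat (negPf jx) /= inE => /orP[/eqP-> //|].
    rewrite mem_cat (negPf jw) orbF def_y mem_cat => /orP[jy'|ju].
      move: sorted_a; rewrite def_a pairwise_cat /= => /and4P[_ _ /allP lek _].
      exact: lek.
    by apply: le_au => //; rewrite def_a mem_cat mem_head orbT.
  have := feasible_bound p1_ge0 p2_ge0 feas leC (ex_intro _ k kL) theta.
  apply: le_trans; rewrite sum_s (negPf kL) /path_length.
  have : \sum_(i <- x) p1 i <=
         \sum_(i <- x) (if L i then Num.min (p1 i) (p2 i) else p2 i).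
    rewrite big_seq [leRHS]big_seq; apply: ler_sum => i ix.
    by rewrite /L ix /= le_min lexx le_x.
  have : \sum_(i <- y ++ w) p2 i <=
         \sum_(i <- y ++ w) (if L i then Num.min (p1 i) (p2 i) else p2 i).
    rewrite big_seq [leRHS]big_seq; apply: ler_sum => i.
    rewrite mem_cat; case: ifPn => // /orP[ix|/andP[iw _] _].
      move: uniq_s; rewrite cat_uniq => /and3P[_ /hasPn nx _].
      rewrite -mem_cat => iyw; have := nx i; rewrite inE iyw orbT => /(_ isT).
      by rewrite /= ix.
    by rewrite le_min leB //= lexx.
  lra.
(* k lies in u: the surplus accumulated on a makes the path at most the total
   load of the second machine. *)
have ku : k \in u by rewrite def_u mem_cat mem_head orbT.
apply: le_trans (feasible_total p1_ge0 feas C_ge0 leC).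
rewrite sum_s /path_length def_x !big_cat /=.
have : \sum_(i <- x') p1 i <= \sum_(i <- x') p2 i.
  rewrite big_seq [leRHS]big_seq; apply: ler_sum => i ix.
  by apply: le_x; rewrite def_x mem_cat ix orbT.
have := gap k ku; lra.
Qed.

Lemma sum_rev f s : \sum_(i <- rev s) f i = \sum_(i <- s) f i :> R.
Proof. by apply: perm_big; rewrite perm_rev. Qed.

Lemma release1 p1 p2 s c :
  (foldl (fun c j => (c.1 + p1 j, Num.max (c.1 + p1 j) c.2 + p2 j)) c s).1
  = c.1 + \sum_(i <- s) p1 i :> R.
Proof.
elim: s c => [|j s IH] c /=; first by rewrite big_nil addr0.
by rewrite IH big_cons /= addrA.
Qed.

Lemma release2_mono p1 p2 s t :
  (forall j, 0 <= p2 j) -> (release p1 p2 s).2 <= (release p1 p2 (s ++ t)).2.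
Proof.
move=> p2_ge0; rewrite /release foldl_cat; set c := foldl _ _ s.
elim: t c => //= j t IH c; apply: le_trans (IH _) => /=.
by rewrite -[leLHS]addr0 lerD // le_max lexx orbT.
Qed.

Lemma release2_le p1 p2 s C :
    (forall j, 0 <= p1 j) -> 0 <= C ->
    (forall x k y, s = x ++ k :: y -> path_length p1 p2 x k y <= C) ->
  (release p1 p2 s).2 <= C.
Proof.
move=> p1_ge0; elim/last_ind: s C => [|s j IH] C C_ge0 path_le; first by [].
have := path_le s j [::]; rewrite -cats1 => /(_ erefl).
rewrite /path_length big_nil addr0 /release cats1 foldl_rcons /= release1 add0r.
move=> le_j; rewrite -lerBrDr ge_max !lerBrDr le_j /= -lerBrDr.
have s_ge0 : 0 <= \sum_(i <- s) p1 i by apply: sumr_ge0.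
apply: IH => [|x k y def_s]; first by have := p1_ge0 j; lra.
have := path_le x k (rcons y j); rewrite def_s rcons_cat => /(_ erefl).
by rewrite /path_length -cats1 big_cat big_seq1 /=; lra.
Qed.

Lemma perm_schedule_feasible p1 p2 s :
    (forall j, 0 <= p1 j) -> (forall j, 0 <= p2 j) ->
    perm_eq s (enum 'I_n) -> feasible p1 p2 (perm_schedule p1 p2 s).
Proof.
move=> p1_ge0 p2_ge0 perm_s.
have in_s j : j \in s by rewrite (perm_mem perm_s) mem_enum.
have takeS j : take (index j s).+1 s = rcons (take (index j s) s) j.
  by rewrite (take_nth j) ?index_mem // nth_index.
(* The state after j is reached before any job of larger index starts. *)
have order i j : (index i s < index j s)%N ->
    exists t, take (index j s) s = rcons (take (index i s) s) i ++ t.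
  move=> ltij; exists (drop (index i s).+1 (take (index j s) s)).
  by rewrite -takeS -[in LHS](cat_take_drop (index i s).+1 (take _ _)) take_takel.
have total i j : i != j -> (index i s < index j s)%N \/ (index j s < index i s)%N.
  move=> neq; have [||e] := ltngtP (index i s) (index j s); auto.
  have := nth_index i (in_s i); rewrite e (nth_index _ (in_s j)) => eji.
  by rewrite eji eqxx in neq.
have rel_rcons t i : release p1 p2 (rcons t i) = ((release p1 p2 t).1 + p1 i,
    Num.max ((release p1 p2 t).1 + p1 i) (release p1 p2 t).2 + p2 i).
  by rewrite /release foldl_rcons.
have ord1 i j : (index i s < index j s)%N ->
    start1 (perm_schedule p1 p2 s) i + p1 i <= start1 (perm_schedule p1 p2 s) j.
  move=> /order[t def_t]; rewrite /= def_t -/(release _ _ _).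
  rewrite [leRHS]release1 big_cat -cats1 big_cat big_seq1 /= /release release1.
  by rewrite -!addrA lerD2l lerD2l lerDl sumr_ge0.
have ord2 i j : (index i s < index j s)%N ->
    start2 (perm_schedule p1 p2 s) i + p2 i <= start2 (perm_schedule p1 p2 s) j.
  move=> /order[t def_t]; rewrite /= def_t le_max; apply/orP; right.
  by have := release2_mono p1 (rcons (take (index i s) s) i) t p2_ge0;
     rewrite rel_rcons.
split=> [j|i j /total[] lt|i j /total[] lt|j].
- by rewrite /= /release release1 add0r sumr_ge0.
- by left; apply: ord1.
- by right; apply: ord1.
- by left; apply: ord2.
- by right; apply: ord2.
- by rewrite /= le_max lexx.
Qed.

Lemma makespan_perm_schedule_le p1 p2 s :
    (forall j, 0 <= p1 j) -> (forall j, 0 <= p2 j) ->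
    perm_eq s (enum 'I_n) ->
  makespan p2 (perm_schedule p1 p2 s) <= (release p1 p2 s).2.
Proof.
move=> p1_ge0 p2_ge0 perm_s; apply/bigmax_leP; split=> [|j _].
  exact: (release2_mono p1 [::] s).
have js : j \in s by rewrite (perm_mem perm_s) mem_enum.
have := release2_mono p1 (take (index j s).+1 s) (drop (index j s).+1 s) p2_ge0.
by rewrite cat_take_drop (take_nth j) ?index_mem // nth_index // /release foldl_rcons.
Qed.

(** A path through a job of a ++ u is compared with the given schedule, a path
    through a job of v ++ b with the reversed schedule. *)
Theorem partly_sorted_optimal p1 p2 a u v b :
    (forall j, 0 <= p1 j) -> (forall j, 0 <= p2 j) ->
    perm_eq (a ++ u ++ v ++ b) (enum 'I_n) ->
    {in a ++ u, forall j, p1 j <= p2 j} ->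
    {in v ++ b, forall j, p2 j <= p1 j} ->
    pairwise (fun i j => p1 i <= p1 j) a ->
    pairwise (fun i j => p2 j <= p2 i) b ->
    {in a & u, forall i j, p1 i <= p1 j} ->
    {in b & v, forall i j, p2 i <= p2 j} ->
    {in u, forall j, \sum_(i <- a) p1 i + p1 j <= \sum_(i <- a) p2 i} ->
    {in v, forall j, \sum_(i <- b) p2 i + p2 j <= \sum_(i <- b) p1 i} ->
  optimal_sequence p1 p2 (a ++ u ++ v ++ b).
Proof.
move=> p1_ge0 p2_ge0 perm_s leA leB sort_a sort_b le_au le_bv gapA gapB.
split=> // [|S feas]; first exact: perm_schedule_feasible.
apply: le_trans (makespan_perm_schedule_le _ _ perm_s) _ => //.
set C := makespan p2 S.
have leC j : start2 S j + p2 j <= C by apply: le_bigmax.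
have C_ge0 : 0 <= C by apply: bigmax_ge_id.
apply: release2_le => // x k y def_s.
rewrite catA in def_s.
have [y' def_au ->|x' -> def_vb] := cat_splitP def_s.
  exact: (path_bound p1_ge0 p2_ge0 feas C_ge0 leC perm_s).
have [feas' leC'] := feasible_reverse feas leC.
have -> : path_length p1 p2 ((a ++ u) ++ x') k y =
          path_length p2 p1 (rev y) k (rev x' ++ rev (a ++ u)).
  by rewrite /path_length -rev_cat !sum_rev; ring.
apply: (path_bound p2_ge0 p1_ge0 feas' C_ge0 leC' (a := rev b) (u := rev v)).
- by rewrite -!rev_cat perm_rev -!catA.
- by move=> j; rewrite -rev_cat mem_rev; apply: leB.
- by move=> j; rewrite mem_rev; apply: leA.
- rewrite -sorted_pairwise; last by move=> ? ? ? /le_trans; apply.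
  rewrite rev_sorted sorted_pairwise //.
  by move=> j1 j2 j3 le21 le13; apply: le_trans le13 le21.
- by move=> i j; rewrite !mem_rev; apply: le_bv.
- by move=> j; rewrite mem_rev !sum_rev; apply: gapB.
- by rewrite -!rev_cat def_vb rev_cat rev_cons -cats1 -catA.
Qed.

End Optimality.

(** * Timed triples for programs *)

Section TimedTriples.
Context {R : realFieldType}.
Implicit Types (m : @memory R) (P : program).

Definition runs P m (T : nat) (Q : memory -> Prop) : Prop :=
  exists (t : nat) (m' : memory), [/\ exec P m t m', (t <= T)%N & Q m'].

Lemma runs_weaken P m T T' (Q Q' : memory -> Prop) :
  (T <= T')%N -> (forall m', Q m' -> Q' m') -> runs P m T Q -> runs P m T' Q'.
Proof.
move=> leT QQ' [t [m' [ex let_ /QQ' Qm']]]; exists t, m'; split=> //.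
exact: leq_trans let_ leT.
Qed.

Lemma runs_seq P P' m T T' (Q Q' : memory -> Prop) :
  runs P m T Q -> (forall m', Q m' -> runs P' m' T' Q') ->
  runs (CSeq P P') m (T + T').+1 Q'.
Proof.
move=> [t [m1 [ex1 let1 Qm1]]] /(_ m1 Qm1)[t' [m2 [ex2 let2 Qm2]]].
exists (t + t').+1, m2; split=> //; first exact: ExecSeq ex1 ex2.
by rewrite ltnS leq_add.
Qed.

(** I k m is an invariant under which at most k rounds remain. *)
Lemma runs_while b P (I : nat -> memory -> Prop) c k m :
    (forall k m, I k m -> teval m b -> (0 < k)%N /\ runs P m c (I k.-1)) ->
    I k m ->
  runs (CWhile b P) m (k.+1 * (tcost b + c).+1)
    (fun m' => ~~ teval m' b /\ exists k', I k' m').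
Proof.
move=> body; elim: k m => [|k IH] m Im; have [bm|nbm] := boolP (teval m b).
- by have [] := body _ _ Im bm.
- exists (tcost b).+1, m; split; [exact: ExecWhileFalse|lia|by split=> //; exists 0%N].
- have [_ [t [m1 [ex1 let1 /IH[t' [m2 [ex2 let2 Qm2]]]]]]] := body _ _ Im bm.
  exists (tcost b + t + t').+1, m2; split=> //; first exact: ExecWhileTrue ex1 ex2.
  by rewrite mulSn; lia.
- exists (tcost b).+1, m; split; [exact: ExecWhileFalse|lia|by split=> //; exists k.+1].
Qed.

Fixpoint loopfree P : bool :=
  match P with
  | CSeq P Q | CIf _ P Q => loopfree P && loopfree Q
  | CWhile _ _ => false
  | _ => true
  end.

(** Effect and cost of a loop-free program, computed without derivations; the
    cost of a conditional is bounded by the sum of its branches. *)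
Fixpoint step P m : memory :=
  match P with
  | CSkip | CWhile _ _ => m
  | CIStore a i e => Memory (upd (imem m) a (ieval m i) (ieval m e)) (vmem m)
  | CVStore a i e => Memory (imem m) (upd (vmem m) a (ieval m i) (veval m e))
  | CSeq P Q => step Q (step P m)
  | CIf b P Q => if teval m b then step P m else step Q m
  end.

Fixpoint bound P : nat :=
  match P with
  | CSkip | CWhile _ _ => 1
  | CIStore _ i e => (icost i + icost e).+1
  | CVStore _ i e => (icost i + vcost e).+1
  | CSeq P Q => (bound P + bound Q).+1
  | CIf b P Q => (tcost b + (bound P + bound Q)).+1
  end.

Lemma runs_step P m (Q : memory -> Prop) :
  loopfree P -> Q (step P m) -> runs P m (bound P) Q.
Proof.
move=> lf Qm; suff [t [ex let_]] : exists t, exec P m t (step P m) /\ (t <= bound P)%N.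
  by exists t, (step P m).
elim: P m lf {Q Qm} => [|a i e|a i e|P IHP P' IHQ|b P IHP P' IHQ|b P _] m //=.
- by exists 1%N; split; first exact: ExecSkip.
- by move=> _; eexists; split; first exact: ExecIStore.
- by move=> _; eexists; split; first exact: ExecVStore.
- move=> /andP[/(IHP m)[t [ex1 le1]] /(IHQ (step P m))[t' [ex2 le2]]].
  by exists (t + t').+1; split; [exact: ExecSeq ex1 ex2|lia].
- move=> /andP[lfP lfQ]; case: ifPn => [bm|nbm].
    have [t [ex1 le1]] := IHP m lfP.
    by exists (tcost b + t).+1; split; [exact: ExecIfTrue|lia].
  have [t [ex1 le1]] := IHQ m lfQ.
  by exists (tcost b + t).+1; split; [exact: ExecIfFalse|lia].
Qed.

End TimedTriples.

(** * Tournament trees *)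

Section Tournament.
Local Open Scope nat_scope.
Context {R : realFieldType}.
Variables (n : nat).
Implicit Types (al : nat -> nat) (F : nat -> R).

(** The tournament tree has nodes 1, ..., 2n - 1; node i has children 2i and
    2i + 1, and job j sits at leaf n + j.  So i is an ancestor of that leaf when
    it is obtained from n + j by halving. *)
Definition below i j := exists k, i = iter k half (n + j).

(** The label v of node i is a job below i that beats all live jobs below i.
    This mentions no other label, hence survives changes elsewhere in the tree.
    If all jobs below i are dead, any of them may label i. *)
Definition winner al F i v : Prop :=
  [/\ (v < n), below i v &
      forall j, (j < n) -> below i j -> (0 < al j) ->
        (0 < al v) /\ (F v <= F j)%R].

Lemma iter_half_le k i : (iter k half i <= i).
Proof. by elim: k => [|k IH] //; rewrite iterS; lia. Qed.

Lemma below_leaf j j' : (j' < n) -> below (n + j) j' -> j' = j.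
Proof.
move=> ltj' [[|k]]; first by move/addnI.
by rewrite iterSr => e; have := iter_half_le k (n + j')./2; lia.
Qed.

Lemma winner_leaf al F j : (j < n) -> winner al F (n + j) j.
Proof.
by move=> ltj; split=> //; [exists 0|move=> j' ltj' /(below_leaf ltj') -> ->].
Qed.

Lemma below_child i j : (i < n) ->
  below i j -> below (i + i) j \/ below (i + i + 1) j.
Proof.
move=> ltin [[|k]]; first by rewrite /=; lia.
rewrite iterS => e; set y := iter k half (n + j) in e.
have [->|->] : i + i = y \/ i + i + 1 = y by lia.
  by left; exists k.
by right; exists k.
Qed.

Lemma below_parent i j : below i j -> below i./2 j.
Proof. by case=> k ->; exists k.+1. Qed.

Lemma winner_node al F i u w : (0 < i < n) ->
    winner al F (i + i) u -> winner al F (i + i + 1) w ->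
  winner al F i
    (if (0 < al u) && ~~ ((0 < al w) && ~~ ((F u <= F w)%R)) then u else w).
Proof.
move=> /andP[i_gt0 ltin] [ltu bu minu] [ltw bw minw].
have {}bu : below i u by have := below_parent bu; have -> : (i + i)./2 = i by lia.
have {}bw : below i w by have := below_parent bw; have -> : (i + i + 1)./2 = i by lia.
case: ifPn => [/andP[alu b]|b]; split=> // j ltj /(below_child ltin)[bj|bj] alj.
- exact: minu.
- have [alw lew] := minw j ltj bj alj; split=> //.
  by move: b; rewrite alw /= negbK => /le_trans; apply.
- have [alu leu] := minu j ltj bj alj.
  move: b; rewrite alu /= negbK => /andP[alw nle]; split=> //.
  by apply: le_trans leu; rewrite ltW // ltNge.
- exact: minw.
Qed.

Lemma below_root j : (0 < n) -> below 1 j.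
Proof.
move=> n_gt0; rewrite /below; have : (0 < n + j) by lia.
have [N] := ubnP (n + j); elim: N (n + j) => // N IH i ltiN i_gt0.
have [->|neq1] := eqVneq i 1; first by exists 0.
have [||k ek] := IH i./2; try lia.
by exists k.+1; rewrite iterSr.
Qed.

Lemma winner_root al F v j : winner al F 1 v -> (j < n) -> (0 < al j) ->
  (0 < al v) /\ (F v <= F j)%R.
Proof. by move=> [_ _ minv] ltj; apply: minv => //; apply: below_root; lia. Qed.

Lemma winner_remove al al' F x v j0 :
    (forall j, al' j = if j == j0 then 0 else al j) -> ~ below x j0 ->
  winner al F x v -> winner al' F x v.
Proof.
move=> al'E nbelow [ltv bv minv]; split=> // j ltj bj; rewrite !al'E.
case: eqP => // _ alj; have [alv lev] := minv j ltj bj alj.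
by case: eqP => // ev; rewrite ev in bv.
Qed.

End Tournament.

(** * The program: loading a class and maintaining its tournament tree *)

(** Memory layout.  Integer array 0 holds n, a loop index, the number of
    extracted jobs and the length of the output written so far; integer array 1
    is the output, 2 marks with 1 the live jobs, those of the current class
    that are not yet extracted, 3 is the tournament tree and 4 lists the
    extracted jobs.  Value arrays 0 and 1 are the input p1 and p2, 2
    and 3 hold the key and the gain of each job of the current class, and array
    4 holds the largest key of the class and the surplus extracted so far.

    The boolean ph is the class being treated: false for A, whose key is p1,
    and true for B, whose key is p2.  As a number it is the input array of the
    keys. *)
Definition nE := ILoad 0 (IConst 0).
Definition iE := ILoad 0 (IConst 1).
Definition cntE := ILoad 0 (IConst 2).
Definition oE := ILoad 0 (IConst 3).
Definition rootE := ILoad 3 (IConst 1).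
Definition pmE := VLoad 4 (IConst 0).
Definition surplusE := VLoad 4 (IConst 1).
Definition set_i e := CIStore 0 (IConst 1) e.
Definition alive e := TILe (IConst 1) (ILoad 2 e).
Definition i_lt e := TNot (TILe e iE).

Definition class_test (ph : bool) :=
  let t := TVLe (VLoad 0 iE) (VLoad 1 iE) in if ph then TNot t else t.

Definition setup_body (ph : bool) :=
  CSeq (CVStore 2 iE (VLoad ph iE))
 (CSeq (CVStore 3 iE (VSub (VLoad (~~ ph) iE) (VLoad ph iE)))
 (CSeq (CIStore 3 (IAdd nE iE) iE)
 (CSeq (CIf (class_test ph)
          (CSeq (CIStore 2 iE (IConst 1))
                (CIf (TVLe pmE (VLoad ph iE))
                     (CVStore 4 (IConst 0) (VLoad ph iE)) CSkip))
          (CIStore 2 iE (IConst 0)))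
       (set_i (IAdd iE (IConst 1)))))).

(** There are no value constants: 0 is obtained as x - x. *)
Definition setup_init :=
  CSeq (set_i (IConst 0))
 (CSeq (CIStore 0 (IConst 2) (IConst 0))
 (CSeq (CVStore 4 (IConst 0) (VSub pmE pmE))
       (CVStore 4 (IConst 1) (VSub pmE pmE)))).

Definition setup ph := CSeq setup_init (CWhile (i_lt nE) (setup_body ph)).

Definition update_node :=
  let l := ILoad 3 (IAdd iE iE) in
  let r := ILoad 3 (IAdd (IAdd iE iE) (IConst 1)) in
  CIf (TAnd (alive l)
            (TNot (TAnd (alive r) (TNot (TVLe (VLoad 2 l) (VLoad 2 r))))))
      (CIStore 3 iE l) (CIStore 3 iE r).

Definition build :=
  CSeq (set_i nE)
       (CWhile (TILe (IConst 2) iE)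
               (CSeq (set_i (ISub iE (IConst 1))) update_node)).

Definition extract :=
  CSeq (CIStore 4 cntE rootE)
 (CSeq (CIStore 0 (IConst 2) (IAdd cntE (IConst 1)))
 (CSeq (CVStore 4 (IConst 1) (VAdd surplusE (VLoad 3 rootE)))
 (CSeq (CIStore 2 rootE (IConst 0))
       (set_i (IHalf (IAdd nE rootE)))))).

Definition repair :=
  CWhile (TILe (IConst 1) iE) (CSeq update_node (set_i (IHalf iE))).

Definition select := CWhile (TNot (TVLe pmE surplusE)) (CSeq extract repair).

Definition emit e := CSeq (CIStore 1 oE e)
  (CSeq (CIStore 0 (IConst 3) (IAdd oE (IConst 1))) (set_i (IAdd iE (IConst 1)))).

(** The jobs of B are extracted by increasing p2 but come in the opposite order
    in the sequence. *)
Definition emit_sorted (ph : bool) :=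
  CSeq (set_i (IConst 0)) (CWhile (i_lt cntE)
    (emit (ILoad 4 (if ph then ISub cntE (IAdd iE (IConst 1)) else iE)))).

Definition emit_rest :=
  CSeq (set_i (IConst 0)) (CWhile (i_lt nE)
    (CIf (alive iE) (emit iE) (set_i (IAdd iE (IConst 1))))).

Definition class_program (ph : bool) :=
  CSeq (setup ph) (CSeq build (CSeq select
    (if ph then CSeq emit_rest (emit_sorted ph)
           else CSeq (emit_sorted ph) emit_rest))).

Definition johnson_program := CSeq (class_program false) (class_program true).

Section Spec.
Context {R : realFieldType}.
Implicit Types (m : @memory R) (ph : bool).

Definition same_io m m' : Prop :=
  [/\ imem m' 0 0 = imem m 0 0, imem m' 0 3 = imem m 0 3,
      imem m' 1 = imem m 1, vmem m' 0 = vmem m 0 & vmem m' 1 = vmem m 1].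

Definition in_class (ph : bool) m i := (vmem m 0 i <= vmem m 1 i) (+) ph.

Lemma in_same ph m m' : same_io m m' -> in_class ph m' =1 in_class ph m.
Proof. by case=> _ _ _ v0 v1 i; rewrite /in_class v0 v1. Qed.

(** For nonnegative keys, the maximum of those of the class among the first i
    jobs, given by its universal property among nonnegative bounds. *)
Definition class_sup ph m i (x : R) : Prop :=
  (forall j, (j < i)%N -> in_class ph m j -> vmem m ph j <= x) /\
  (forall y, 0 <= y -> (forall j, (j < i)%N -> in_class ph m j -> vmem m ph j <= y) ->
    x <= y).

Definition loaded ph m0 m j : Prop :=
  [/\ vmem m 2 j = vmem m0 ph j, vmem m 3 j = vmem m0 (~~ ph) j - vmem m0 ph j,
      imem m 3 (imem m0 0 0 + j)%N = j & (0 < imem m 2 j)%N = in_class ph m0 j].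

Definition setup_post ph m0 i m : Prop :=
  [/\ same_io m0 m, imem m 0 2 = 0%N,
      class_sup ph m0 i (vmem m 4 0), vmem m 4 1 = 0 &
      forall j, (j < i)%N -> loaded ph m0 m j].

Lemma setup_step ph m : let m' := step (setup_body ph) m in
  let i := imem m 0 1 in
  [/\ imem m' 0 1 = i.+1, same_io m m', imem m' 0 2 = imem m 0 2,
      vmem m' 4 1 = vmem m 4 1 & [/\ 
      vmem m' 4 0 = (if in_class ph m i then Num.max (vmem m 4 0) (vmem m ph i)
                     else vmem m 4 0),
      loaded ph m m' i &
      forall j, j != i ->
        [/\ vmem m' 2 j = vmem m 2 j, vmem m' 3 j = vmem m 3 j, imem m' 2 j = imem m 2 j &
            imem m' 3 (imem m 0 0 + j)%N = imem m 3 (imem m 0 0 + j)%N]]].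
Proof.
rewrite /loaded /in_class /setup_body; case: ph => /=; rewrite /upd /=;
  rewrite ?addbT ?addbF; case: ifPn => // c1; try (case: ifPn => c2);
  (split; [by rewrite /upd /= ?addn1 | by split | by [] | by [] |]);
  split; rewrite /= /upd /= ?eqxx //.
all: try by move=> j nj; rewrite ?eqn_add2l (negPf nj).
all: try by rewrite (negPf c1).
all: by rewrite maxEle ?c2 ?(negPf c2).
Qed.

Lemma same_io_trans m1 m2 m3 : same_io m1 m2 -> same_io m2 m3 -> same_io m1 m3.
Proof. by move=> [e1 e2 e3 e4 e5] [f1 f2 f3 f4 f5]; split; congruence. Qed.

Lemma setup_runs ph : exists c, forall m,
  runs (setup ph) m (c * (imem m 0 0).+1) (setup_post ph m (imem m 0 0)).
Proof.
exists (bound setup_init + (tcost (i_lt nE) + bound (setup_body ph)).+2)%N => m.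
set n := imem m 0 0.
pose I k m' := exists i, [/\ (i + k = n)%N, imem m' 0 1 = i & setup_post ph m i m'].
have init : runs setup_init m (bound setup_init) (I n).
  apply: runs_step => //; exists 0%N; split=> //; split=> //.
  - by rewrite /= /upd /= subrr; split.
  - by rewrite /= /upd /= !subrr.
have body k m1 : I k m1 -> teval m1 (i_lt nE) ->
    (0 < k)%N /\ runs (setup_body ph) m1 (bound (setup_body ph)) (I k.-1).
  move=> [i [eik im [io cnt pm sur ld]]] /=; rewrite im.
  have [n0 _ _ v0 v1] := io; rewrite n0 -ltnNge => ltin; split; first by lia.
  apply: runs_step; first by case: (ph).
  have [im' io' cnt' sur' [pm' [l1 l2 l3 l4] other]] := setup_step ph m1.
  have vE (x : bool) : vmem m1 x = vmem m x by case: x.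
  rewrite im in im' pm' l1 l2 l3 l4 other.
  exists i.+1; split; [by lia|by []|split].
  - exact: same_io_trans io io'.
  - by rewrite cnt'.
  - case: pm => le_pm pm_le; rewrite pm' (in_same _ io) vE; split=> [j|y y_ge0 le_y].
      rewrite ltnS leq_eqVlt => /predU1P[->|ltji] cj.
        by rewrite cj le_max lexx orbT.
      by case: ifP => _; rewrite ?le_max le_pm.
    have pmy : vmem m1 4 0 <= y by apply: pm_le => // j ltji; apply: le_y; lia.
    by case: ifP => // ci; rewrite ge_max pmy le_y.
  - by rewrite sur'.
  - move=> j; rewrite ltnS leq_eqVlt => /predU1P[->|ltji].
      by split; rewrite ?l1 ?l2 ?l4 ?vE ?(in_same _ io) // -n0 l3.
    have [|o1 o2 o3 o4] := other j; first by rewrite ltn_eqF.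
    by have [] := ld j ltji; rewrite -n0 /loaded o1 o2 o3 -n0 o4; split.
apply: runs_weaken (runs_seq init (fun m1 => runs_while body)).
  by rewrite mulnDl; nia.
move=> m' [nlt [k [i [eik im post]]]].
have -> // : n = i.
have [[n0 _ _ _ _] _ _ _ _] := post.
move: nlt; rewrite /= im n0 -/n; lia.
Qed.

Definition only_tree m m' : Prop :=
  [/\ same_io m m', imem m' 0 2 = imem m 0 2, imem m' 2 = imem m 2,
      imem m' 4 = imem m 4 & vmem m' = vmem m].

Lemma only_tree_trans m1 m2 m3 :
  only_tree m1 m2 -> only_tree m2 m3 -> only_tree m1 m3.
Proof.
move=> [io1 e1 e2 e3 e4] [io2 f1 f2 f3 f4].
by split; first exact: same_io_trans io1 io2; congruence.
Qed.

Definition node_ok m x : Prop :=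
  winner (imem m 0 0) (imem m 2) (vmem m 2) x (imem m 3 x).

Definition tree_ok m : Prop :=
  forall x, (0 < x < (imem m 0 0).*2)%N -> node_ok m x.

Lemma update_node_ok m (i := imem m 0 1) (m' := step update_node m) :
    (0 < i < imem m 0 0)%N -> node_ok m (i + i)%N -> node_ok m (i + i + 1)%N ->
  [/\ only_tree m m', imem m' 0 1 = i, node_ok m' i &
      forall x, x != i -> node_ok m x -> node_ok m' x].
Proof.
move=> ltin okl okr.
have okv := winner_node ltin okl okr; set v := if _ then _ else _ in okv.
have -> : m' = Memory (upd (imem m) 3 i v) (vmem m).
  by rewrite /m' /= -/i /v; case: ifP.
split=> // [|x /negPf neqx okx].
  by rewrite /node_ok /= /upd /= eqxx.
by rewrite /node_ok /= /upd /= neqx.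
Qed.

(** Nodes are labelled from n - 1 down to 1, children first. *)
Lemma build_runs : exists c, forall m, (0 < imem m 0 0)%N ->
    (forall j, (j < imem m 0 0)%N -> imem m 3 (imem m 0 0 + j)%N = j) ->
  runs build m (c * (imem m 0 0).+1) (fun m' => only_tree m m' /\ tree_ok m').
Proof.
pose loop := CSeq (set_i (ISub iE (IConst 1))) update_node.
exists (bound (set_i nE) + (tcost (TILe (IConst 2) iE) + bound loop).+2)%N => m.
set n := imem m 0 0 => n_gt0 leaves.
pose I k m' := [/\ imem m' 0 1 = k, (0 < k <= n)%N, only_tree m m' &
                   forall x, (k <= x < n.*2)%N -> node_ok m' x].
have init : runs (set_i nE) m (bound (set_i nE)) (I n).
  apply: runs_step => //; split=> //; first by rewrite n_gt0 leqnn.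
  move=> x /andP[lenx ltx]; rewrite /node_ok /= /upd /= -/n.
  have -> : x = (n + (x - n))%N by lia.
  by rewrite leaves; [apply: winner_leaf; lia | lia].
have body k m1 : I k m1 -> teval m1 (TILe (IConst 2) iE) ->
    (0 < k)%N /\ runs loop m1 (bound loop) (I k.-1).
  move=> [im /andP[k_gt0 lekn] ot ok] /=; rewrite im => lt1k; split=> //.
  apply: runs_step => //.
  set m2 := step (set_i (ISub iE (IConst 1))) m1.
  rewrite -[step loop m1]/(step update_node m2).
  have n2 : imem m2 0 0 = n by case: ot => -[].
  have im2 : imem m2 0 1 = k.-1 by rewrite /= /upd /= im subn1.
  have ok2 x : (k <= x < n.*2)%N -> node_ok m2 x by apply: ok.
  have ot2 : only_tree m m2 by apply: only_tree_trans ot _; split.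
  have := @update_node_ok m2; rewrite im2 n2.
  case; [lia | apply: ok2; lia | apply: ok2; lia |].
  move=> ot3 im3 okk okx; split=> //; first lia.
    exact: only_tree_trans ot2 ot3.
  move=> x lex; have [->//|neq] := eqVneq x k.-1.
  by apply: okx => //; apply: ok2; lia.
apply: runs_weaken (runs_seq init (fun m1 => runs_while body)).
  by rewrite mulnDl; nia.
move=> m' [nlt [k [im lek ot ok]]]; split=> // x; have [[-> _ _ _ _] _ _ _ _] := ot.
by move=> ltx; apply: ok; move: nlt; rewrite /= im -/n; lia.
Qed.

(** Only the ancestors of the removed leaf may have a wrong label; the loop
    climbs through them.  Since the starting node is less than
    n < 2 ^ (trunc_log 2 n).+1, it reaches 0 after (trunc_log 2 n).+1 halvings. *)
Lemma repair_runs : exists c, forall m, (imem m 0 1 < imem m 0 0)%N ->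
    (forall x, (0 < x < (imem m 0 0).*2)%N ->
       (forall k, x <> iter k half (imem m 0 1)) -> node_ok m x) ->
  runs repair m (c * (trunc_log 2 (imem m 0 0)).+2)
    (fun m' => only_tree m m' /\ tree_ok m').
Proof.
pose loop := CSeq update_node (set_i (IHalf iE)).
exists (tcost (TILe (IConst 1) iE) + bound loop).+1 => m.
set n := imem m 0 0 => ltin ok0.
pose I k m' := [/\ (imem m' 0 1 < 2 ^ k)%N, (imem m' 0 1 < n)%N, only_tree m m' &
  forall x, (0 < x < n.*2)%N -> (forall k, x <> iter k half (imem m' 0 1)) ->
    node_ok m' x].
have init : I (trunc_log 2 n).+1 m.
  by split=> //; apply: (ltn_trans ltin); apply: trunc_log_ltn.
have body k m1 : I k m1 -> teval m1 (TILe (IConst 1) iE) ->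
    (0 < k)%N /\ runs loop m1 (bound loop) (I k.-1).
  move=> [ik ltn ot ok] /=; set i := imem m1 0 1 in ik ltn ok * => i_gt0.
  have k_gt0 : (0 < k)%N by case: k ik => //; rewrite expn0; lia.
  split=> //; apply: runs_step => //.
  have n1 : imem m1 0 0 = n by case: ot => -[].
  have := @update_node_ok m1; rewrite -/i n1.
  case.
  - by rewrite i_gt0 ltn.
  - by apply: ok => [|k' e]; [lia|have := iter_half_le k' i; lia].
  - by apply: ok => [|k' e]; [lia|have := iter_half_le k' i; lia].
  set m2 := step update_node m1 => ot2 im2 oki okx.
  rewrite -[step loop m1]/(step (set_i (IHalf iE)) m2).
  set m3 := step _ m2.
  have im3 : imem m3 0 1 = i./2 by rewrite /= /upd /= im2.
  have ot3 : only_tree m m3.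
    by apply: only_tree_trans ot (only_tree_trans ot2 _); split.
  split=> //; rewrite ?im3.
  - by case: (k) k_gt0 ik => // k' _; rewrite expnS /=; lia.
  - lia.
  move=> x ltx nchain; have [->//|neq] := eqVneq x i.
  have [|//] := okx x neq _.
  apply: ok => // -[|k'] e; first by rewrite e eqxx in neq.
  by apply: (nchain k'); rewrite e iterSr.
apply: runs_weaken (runs_while body init); first by rewrite mulnC.
move=> m' [nlt [k [_ _ ot ok]]]; split=> // x; have [[-> _ _ _ _] _ _ _ _] := ot.
move=> ltx; apply: ok => // k' e; move: nlt; rewrite /=.
by have := iter_half_le k' (imem m' 0 1); lia.
Qed.

End Spec.

(** * Extraction in increasing order *)

Section Ranking.
Context {R : realFieldType} {T : eqType}.
Variables (X : pred T) (F : T -> R).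
Implicit Types E Y : seq T.

Definition smallest E : Prop :=
  [/\ uniq E, all X E, pairwise (fun i j => F i <= F j) E &
      forall e j, e \in E -> X j -> j \notin E -> F e <= F j].

Lemma smallest_rcons E v :
    smallest E -> X v -> v \notin E ->
    (forall j, X j -> j \notin E -> F v <= F j) -> smallest (rcons E v).
Proof.
move=> [uE aE pE rE] Xv nv minv; split.
- by rewrite rcons_uniq nv uE.
- by rewrite all_rcons Xv aE.
- rewrite -cats1 pairwise_cat pE /= !andbT.
  by apply/allrelP => e j eE; rewrite inE => /eqP->; apply: rE.
- move=> e j; rewrite !mem_rcons !inE negb_or => /predU1P[->|eE] Xj /andP[_ nj].
    exact: minv.
  exact: rE.
Qed.

(** Y is a candidate stopping point: because of the strict inequality, any
    extraction in increasing order passes through exactly the set Y. *)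
Definition initial Y : Prop :=
  [/\ uniq Y, all X Y & forall y j, y \in Y -> X j -> j \notin Y -> F y < F j].

(** An extracted job outside Y would have a larger key than some job of Y that
    is still waiting. *)
Lemma smallest_sub E Y :
  smallest E -> initial Y -> (size E <= size Y)%N -> {subset E <= Y}.
Proof.
move=> [uE aE _ rE] [uY aY ltY] leEY e eE; apply: contraT => nYe.
have [y yY nEy] : exists2 y, y \in Y & y \notin E.
  apply/hasP; rewrite has_predC; apply: contra nYe => /allP sYE.
  by rewrite (uniq_min_size uY sYE leEY).2.
have := lt_le_trans (ltY y e yY (allP aE e eE) nYe) (rE e y eE (allP aY y yY) nEy).
by rewrite ltxx.
Qed.

End Ranking.

Section Selection.
Context {R : realFieldType}.
Implicit Types (m : @memory R) (ph : bool).

Definition candidate m j := (j < imem m 0 0)%N && (0 < imem m 2 j)%N.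

Definition selected m E m' : Prop :=
  [/\ same_io m m', smallest (candidate m) (vmem m 2) E, imem m' 0 2 = size E,
      [seq imem m' 4 i | i <- iota 0 (size E)] = E &
      forall j, imem m' 2 j = if j \in E then 0%N else imem m 2 j].

Lemma extract_step m (v := imem m 3 1) (m' := step extract m) :
  [/\ same_io m m', imem m' 0 1 = (imem m 0 0 + v)./2, imem m' 0 2 = (imem m 0 2).+1,
      forall j, imem m' 2 j = (if j == v then 0%N else imem m 2 j) &
      [/\ imem m' 3 = imem m 3, vmem m' 2 = vmem m 2, vmem m' 3 = vmem m 3,
          vmem m' 4 0 = vmem m 4 0 & vmem m' 4 1 = vmem m 4 1 + vmem m 3 v]].
Proof. by split=> //; rewrite /m' /= /upd /= ?addn1. Qed.

Lemma extract_mem4 m j :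
  imem (step extract m) 4 j = if j == imem m 0 2 then imem m 3 1 else imem m 4 j.
Proof. by []. Qed.

(** As long as the surplus is too small, fewer than size Y jobs are extracted:
    otherwise these would be the jobs of Y, whose surplus is large enough. *)
Lemma select_runs : exists c, forall m Y, tree_ok m ->
    imem m 0 2 = 0%N -> vmem m 4 1 = 0 ->
    initial (candidate m) (vmem m 2) Y ->
    vmem m 4 0 <= \sum_(j <- Y) vmem m 3 j ->
  runs select m (c * ((size Y).+1 * (trunc_log 2 (imem m 0 0)).+2))
    (fun m' => exists2 E, selected m E m' & vmem m 4 0 <= \sum_(j <- E) vmem m 3 j).
Proof.
have [c repairP] := @repair_runs R; pose b := TNot (TVLe pmE surplusE).
exists (tcost b + (bound extract + c).+1).+1 => m Y tree0 cnt0 sur0 initY leY.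
set n := imem m 0 0; set t := trunc_log 2 n.
pose I k m' := exists E, [/\ selected m E m', tree_ok m',
  vmem m' 4 1 = \sum_(j <- E) vmem m 3 j, (k + size E = size Y)%N &
  [/\ vmem m' 2 = vmem m 2, vmem m' 3 = vmem m 3 & vmem m' 4 0 = vmem m 4 0]].
have init : I (size Y) m.
  by exists [::]; split=> //; rewrite ?big_nil ?addn0.
have body k m1 : I k m1 -> teval m1 b -> (0 < k)%N /\
    runs (CSeq extract repair) m1 (bound extract + c * t.+2).+1 (I k.-1).
  move=> [E [[io sE cntE memE alE] tree surE size_k [v2 v3 v4]]] /=.
  rewrite surE v4 => nle.
  have leE : (size E <= size Y)%N by rewrite -size_k leq_addl.
  have sub := smallest_sub sE initY leE.
  have [uE _ _ _] := sE; have [uY aY _] := initY.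
  have n1 : imem m1 0 0 = n by case: io.
  have [y yY nyE] : exists2 y, y \in Y & y \notin E.
    apply/hasP; rewrite has_predC; apply: contraNN nle => /allP sYE.
    rewrite (perm_big Y) //=; apply: uniq_perm => // x.
    by apply/idP/idP; [apply: sub | apply: sYE].
  have k_gt0 : (0 < k)%N.
    rewrite lt0n; apply: contraNneq nyE => k0.
    have leYE : (size Y <= size E)%N by rewrite -size_k k0.
    by rewrite (uniq_min_size uE sub leYE).2.
  split=> //; set v := imem m1 3 1.
  have candE j : candidate m j -> j \notin E -> (j < n)%N /\ (0 < imem m1 2 j)%N.
    by move=> /andP[ltj alj] njE; rewrite alE (negPf njE).
  have [lt_y al_y] := candE y (allP aY y yY) nyE.
  have win : node_ok m1 1 by apply: tree; rewrite n1; lia.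
  rewrite /node_ok n1 -/v in win; have [ltv _ _] := win.
  have [alv _] := winner_root win lt_y al_y.
  have nvE : v \notin E by apply: contraTN alv => vE; rewrite alE vE.
  have [io' im' cnt' al' [tr' v2' v3' v4' sur']] := extract_step m1.
  rewrite -/v n1 in im' al' sur'.
  have sel' : selected m (rcons E v) (step extract m1).
    split.
    - exact: same_io_trans io io'.
    - apply: smallest_rcons => //.
        by rewrite /candidate ltv; move: alv; rewrite alE (negPf nvE).
      move=> j /candE cj /cj[ltj alj]; rewrite -v2.
      by have [] := winner_root win ltj alj.
    - by rewrite cnt' cntE size_rcons.
    - rewrite size_rcons -(addn1 (size E)) iotaD map_cat add0n -cats1; congr (_ ++ _).
        rewrite -[RHS]memE; apply/eq_in_map => i; rewrite mem_iota add0n => lti.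
        by rewrite extract_mem4 cntE ltn_eqF.
      rewrite -[LHS]/[:: imem (step extract m1) 4 (size E)].
      by rewrite extract_mem4 cntE eqxx.
    - by move=> j; rewrite al' alE mem_rcons inE; case: eqP.
  set m2 := step extract m1 in io' im' cnt' al' tr' v2' v3' v4' sur' sel' *.
  have n2 : imem m2 0 0 = n by case: io' => ->.
  apply: (runs_seq (runs_step (Q := fun m' => m' = m2) _ _)) => // _ ->.
  have t2 : t = trunc_log 2 (imem m2 0 0) by rewrite n2.
  rewrite t2; apply: runs_weaken (repairP m2 _ _) => //.
  - move=> m3 [[io3 cnt3 al3 ext3 v3E] tree3]; exists (rcons E v); split=> //.
    + case: sel' => s1 s2 s3 s4 s5; split=> //; rewrite ?ext3 ?cnt3 ?al3 //.
      exact: same_io_trans s1 io3.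
    + by rewrite v3E sur' surE v3 -cats1 big_cat big_seq1.
    + by rewrite size_rcons; lia.
    + by rewrite v3E v2' v3' v4'.
  - by rewrite n2 im'; lia.
  move=> x; rewrite n2 im' => ltx nchain; rewrite /node_ok n2 v2' tr'.
  (* The leaf of v keeps its label: no live job is below it any more. *)
  have [->|neqx] := eqVneq x (n + v)%N.
    have [|ltw bw _] := tree (n + v)%N; first by rewrite n1; lia.
    rewrite n1 in ltw bw; rewrite (below_leaf ltw bw).
    exact: winner_leaf.
  apply: (winner_remove al').
    case=> -[|k']; first by move/eqP; rewrite (negPf neqx).
    by rewrite iterSr; apply: nchain.
  by rewrite -n1; apply: tree; rewrite n1.
apply: runs_weaken (runs_while body init); first by nia.
move=> m' [nlt [k [E [sel _ sur _ [_ _ v4]]]]]; exists E => //.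
by move: nlt; rewrite /= negbK sur v4.
Qed.

End Selection.

(** * Writing the output *)

Section Emission.
Context {R : realFieldType}.
Implicit Types (m : @memory R) (ph : bool) (L E : seq nat).

Definition written m L : Prop :=
  imem m 0 3 = size L /\ [seq imem m 1 i | i <- iota 0 (size L)] = L.

Definition only_output m m' : Prop :=
  [/\ imem m' 0 0 = imem m 0 0, imem m' 0 2 = imem m 0 2,
      imem m' 2 = imem m 2, imem m' 4 = imem m 4 & vmem m' = vmem m].

Lemma only_output_trans m1 m2 m3 :
  only_output m1 m2 -> only_output m2 m3 -> only_output m1 m3.
Proof. by move=> [e1 e2 e3 e4 e5] [f1 f2 f3 f4 f5]; split; congruence. Qed.

Lemma emit_step m e L (m' := step (emit e) m) :
  written m L ->
  [/\ only_output m m', imem m' 0 1 = (imem m 0 1).+1 &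
      written m' (rcons L (ieval m e))].
Proof.
move=> [o outL]; split; [by split | by rewrite /m' /= /upd /= addn1 |].
split; rewrite size_rcons; first by rewrite /m' /= /upd /= o addn1.
have out j : imem m' 1 j = if j == size L then ieval m e else imem m 1 j.
  by rewrite -o.
rewrite -(addn1 (size L)) iotaD map_cat add0n -cats1; congr (_ ++ _).
  rewrite -[RHS]outL; apply/eq_in_map => i; rewrite mem_iota add0n => lti.
  by rewrite out ltn_eqF.
by rewrite -[LHS]/[:: imem m' 1 (size L)] out eqxx.
Qed.

Lemma emit_sorted_runs ph : exists c, forall m L E,
    written m L -> imem m 0 2 = size E ->
    [seq imem m 4 i | i <- iota 0 (size E)] = E ->
  runs (emit_sorted ph) m (c * (size E).+1)
    (fun m' => only_output m m' /\ written m' (L ++ if ph then rev E else E)).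
Proof.
pose e := ILoad 4 (if ph then ISub cntE (IAdd iE (IConst 1)) else iE).
exists (bound (set_i (IConst 0)) + (tcost (i_lt cntE) + bound (emit e)).+2)%N.
move=> m L E outL cntE' memE; set Z := if ph then _ else _.
have size_Z : size Z = size E by rewrite /Z; case: (ph); rewrite ?size_rev.
have nthE i : (i < size E)%N -> imem m 4 i = nth 0%N E i.
  by move=> lti; rewrite -[in RHS]memE (nth_map 0%N) ?size_iota // nth_iota.
pose I k m' := exists i, [/\ (i + k = size E)%N, imem m' 0 1 = i, only_output m m' &
                          written m' (L ++ take i Z)].
have init : runs (set_i (IConst 0)) m (bound (set_i (IConst 0))) (I (size E)).
  by apply: runs_step => //; exists 0%N; rewrite take0 cats0.
have body k m1 : I k m1 -> teval m1 (i_lt cntE) ->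
    (0 < k)%N /\ runs (emit e) m1 (bound (emit e)) (I k.-1).
  move=> [i [eik im oo wr]] /=; rewrite im; have [_ -> _ ext _] := oo.
  rewrite cntE' -ltnNge => lti; split; first by lia.
  apply: runs_step => //; have [oo' im' wr'] := emit_step e wr.
  exists i.+1; split; [lia | by rewrite im' im | exact: only_output_trans oo oo' |].
  rewrite (take_nth 0%N) ?size_Z // -rcons_cat.
  have -> : nth 0%N Z i = ieval m1 e; last by [].
  have [_ cnt1 _ ext1 _] := oo; rewrite /= ext1 /Z; case: (ph) => /=.
    by rewrite im cnt1 cntE' addn1 nthE ?nth_rev //; lia.
  by rewrite im nthE.
apply: runs_weaken (runs_seq init (fun m1 => runs_while body)).
  by rewrite mulnDl; nia.
move=> m' [nlt [k [i [eik im oo wr]]]]; split=> //; suff ei : i = size Z.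
  by rewrite ei take_size in wr.
by move: nlt; rewrite /= im; have [_ -> _ _ _] := oo; rewrite cntE'; lia.
Qed.

Lemma emit_rest_runs : exists c, forall m L, written m L ->
  runs emit_rest m (c * (imem m 0 0).+1)
    (fun m' => only_output m m' /\
       written m' (L ++ [seq j <- iota 0 (imem m 0 0) | (0 < imem m 2 j)%N])).
Proof.
pose loop := CIf (alive iE) (emit iE) (set_i (IAdd iE (IConst 1))).
exists (bound (set_i (IConst 0)) + (tcost (i_lt nE) + bound loop).+2)%N.
move=> m L outL; set n := imem m 0 0; pose p j := (0 < imem m 2 j)%N.
pose I k m' := exists i, [/\ (i + k = n)%N, imem m' 0 1 = i, only_output m m' &
                          written m' (L ++ [seq j <- iota 0 i | p j])].
have init : runs (set_i (IConst 0)) m (bound (set_i (IConst 0))) (I n).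
  by apply: runs_step => //; exists 0%N; rewrite cats0.
have body k m1 : I k m1 -> teval m1 (i_lt nE) ->
    (0 < k)%N /\ runs loop m1 (bound loop) (I k.-1).
  move=> [i [eik im oo wr]] /=; rewrite im; have [n1 _ al _ _] := oo.
  rewrite n1 -ltnNge => lti; split; first by lia.
  apply: runs_step => //; exists i.+1; split; first by lia.
  - by rewrite /=; case: ifP => _; rewrite /= /upd /= im addn1.
  - apply: only_output_trans oo _.
    by rewrite /=; case: ifP => _; split.
  rewrite -[step loop m1]/(if (0 < imem m1 2 (imem m1 0 1))%N
    then step (emit iE) m1 else step (set_i (IAdd iE (IConst 1))) m1).
  rewrite -(addn1 i) iotaD filter_cat /= add0n {2}/p -al im catA.
  case: ifP => _; last by rewrite cats0.
  by have [_ _] := emit_step iE wr; rewrite cats1 -im.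
apply: runs_weaken (runs_seq init (fun m1 => runs_while body)).
  by rewrite mulnDl; nia.
move=> m' [nlt [k [i [eik im oo wr]]]]; split=> //; suff -> : n = i by [].
by move: nlt; rewrite /= im; have [-> _ _ _ _] := oo; lia.
Qed.

End Emission.

(** * Correctness and running time of the program *)

Section RankingExt.
Context {R : realFieldType} {T : eqType}.
Variables (X X' : pred T) (F F' : T -> R).
Hypotheses (eqX : X =1 X') (eqF : forall j, X j -> F j = F' j).

Lemma eq_smallest E : smallest X F E -> smallest X' F' E.
Proof.
move=> [uE aE pE rE]; split=> //; first by rewrite -(eq_all eqX).
  apply: (sub_in_pairwise _ aE pE) => i j Xi Xj.
  by rewrite /= -!eqF.
move=> e j eE; rewrite -eqX => Xj njE; rewrite -!eqF //; first exact: rE.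
exact: (allP aE).
Qed.

Lemma eq_initial Y : initial X F Y -> initial X' F' Y.
Proof.
move=> [uE aE rE]; split=> //; first by rewrite -(eq_all eqX).
move=> e j eE; rewrite -eqX => Xj njE; rewrite -!eqF //; first exact: rE.
exact: (allP aE).
Qed.

End RankingExt.

Section JohnsonProgram.
Context {R : realFieldType}.
Implicit Types (m : @memory R) (ph : bool) (L E Y : seq nat).

Definition class_job m ph j := (j < imem m 0 0)%N && in_class ph m j.

Definition gain m ph Y : R := \sum_(j <- Y) (vmem m (~~ ph) j - vmem m ph j).

(** The stopping condition of the extraction: the surplus reaches the largest
    key of the class. *)
Definition covers m ph Y : Prop :=
  forall j, class_job m ph j -> vmem m ph j <= gain m ph Y.

Definition class_rest m ph E :=
  [seq j <- iota 0 (imem m 0 0) | in_class ph m j && (j \notin E)].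

Definition class_post ph m L m' : Prop :=
  [/\ imem m' 0 0 = imem m 0 0, vmem m' 0 = vmem m 0, vmem m' 1 = vmem m 1 &
  exists E, [/\ smallest (class_job m ph) (vmem m ph) E, covers m ph E &
    written m' (L ++ if ph then class_rest m ph E ++ rev E
                     else E ++ class_rest m ph E)]].

Lemma class_program_runs ph : exists c, forall m L Y, (0 < imem m 0 0)%N ->
    written m L -> initial (class_job m ph) (vmem m ph) Y -> covers m ph Y ->
    0 <= gain m ph Y ->
  runs (class_program ph) m
    (c * (imem m 0 0 + (size Y).+1 * (trunc_log 2 (imem m 0 0)).+2).+1)
    (class_post ph m L).
Proof.
have [c1 setupP] := @setup_runs R ph.
have [c2 buildP] := @build_runs R.
have [c3 selectP] := @select_runs R.
have [c4 sortedP] := @emit_sorted_runs R ph.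
have [c5 restP] := @emit_rest_runs R.
exists (c1 + c2 + c3 + c4 + c5 + 5)%N => m L Y.
set n := imem m 0 0 => n_gt0 outL initY covY gainY.
set s := ((size Y).+1 * _)%N.
suff main : runs (class_program ph) m (c1 * n.+1 + (c2 * n.+1 +
    (c3 * s + ((c4 + c5) * n.+1).+1).+1).+1).+1 (class_post ph m L).
  by apply: runs_weaken main => //; rewrite /n; nia.
apply: runs_seq (setupP m) _ => m1 [io1 cnt1 sup1 sur1 ld1].
have n1 : imem m1 0 0 = n by case: io1.
have [le_pm pm_le] := sup1.
rewrite -n1; apply: runs_seq (buildP m1 _ _) _; first by rewrite n1.
  by rewrite n1 => j /ld1[].
move=> m2 [[io2 cnt2 al2 ext2 v2] tree2].
have io12 := same_io_trans io1 io2.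
have n2 : imem m2 0 0 = n by case: io12.
have candE : candidate m2 =1 class_job m ph.
  move=> j; rewrite /candidate /class_job n2 al2 -/n.
  by case: ltnP => // /ld1[_ _ _ ->].
have F2 j : candidate m2 j -> vmem m2 2 j = vmem m ph j.
  by rewrite /candidate n2 v2 => /andP[/ld1[-> _ _ _]].
have H2 Z : all (candidate m2) Z -> \sum_(j <- Z) vmem m2 3 j = gain m ph Z.
  move=> /allP aZ; rewrite /gain big_seq [RHS]big_seq; apply: eq_bigr => j /aZ.
  by rewrite /candidate n2 v2 => /andP[/ld1[_ -> _ _]].
have initY2 : initial (candidate m2) (vmem m2 2) Y.
  apply: eq_initial initY => [j|j cj]; first by rewrite candE.
  by rewrite F2 ?candE.
have [uY aY _] := initY2.
have -> : (c3 * s = c3 * ((size Y).+1 * (trunc_log 2 (imem m2 0 0)).+2))%N.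
  by rewrite n2.
apply: runs_seq (selectP m2 Y tree2 _ _ initY2 _) _.
- by rewrite cnt2.
- by rewrite v2.
- rewrite H2 // v2; apply: pm_le => // j ltj cj.
  by apply: covY; rewrite /class_job ltj.
move=> m3 [E [io3 sE cnt3 ext3 al3]]; have [uE aE _ _] := sE.
rewrite H2 // v2 => leE.
have io13 := same_io_trans io12 io3.
have n3 : imem m3 0 0 = n by case: io13.
have out3 : written m3 L by case: io13 outL => _ o3 o1 _ _; rewrite /written o3 o1.
have size_E : (size E <= n)%N.
  rewrite -(size_iota 0 n); apply: uniq_leq_size => // j /(allP aE).
  by rewrite /candidate n2 mem_iota => /andP[].
have restE : [seq j <- iota 0 n | (0 < imem m3 2 j)%N] = class_rest m ph E.
  apply: eq_in_filter => j; rewrite mem_iota /= add0n => ltj; rewrite al3.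
  have := candE j; rewrite /candidate /class_job n2 ltj /= => <-.
  by case: (j \in E); rewrite ?andbF ?andbT.
have post m' : only_output m3 m' ->
    written m' (L ++ if ph then class_rest m ph E ++ rev E
                     else E ++ class_rest m ph E) -> class_post ph m L m'.
  move=> [n' _ _ _ v'] out'; rewrite /class_post n' v'.
  case: io13 => n31 _ _ v0 v1; split=> //; exists E; split=> //.
    exact: eq_smallest candE F2 _ sE.
  move=> j /andP[ltj cj]; apply: le_trans leE.
  by apply: le_pm.
have {}sortedP m' L' : only_output m3 m' -> written m' L' ->
    runs (emit_sorted ph) m' (c4 * (size E).+1)
      (fun m'' => only_output m3 m'' /\ written m'' (L' ++ if ph then rev E else E)).
  move=> oo wr; have [_ cnt' _ ext' _] := oo.
  apply: runs_weaken (sortedP m' L' E wr _ _); rewrite ?cnt' ?ext' //.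
  by move=> m'' [oo' wr']; split=> //; apply: only_output_trans oo oo'.
have {}restP m' L' : only_output m3 m' -> written m' L' ->
    runs emit_rest m' (c5 * n.+1)
      (fun m'' => only_output m3 m'' /\ written m'' (L' ++ class_rest m ph E)).
  move=> oo wr; have [n' _ al' _ _] := oo.
  have := restP m' L' wr; rewrite n' n3 al' restE.
  apply: runs_weaken => // m'' [oo' wr']; split=> //.
  exact: only_output_trans oo oo'.
have oo3 : only_output m3 m3 by [].
rewrite mulnDl; move: sortedP restP post; case: (ph) => sortedP restP post.
  apply: runs_weaken (runs_seq (restP m3 L oo3 out3) _); last first.
  - move=> m4 [oo4 wr4]; exact: sortedP m4 _ oo4 wr4.
  - by move=> m4 [oo4]; rewrite -catA; apply: post.
  nia.
apply: runs_weaken (runs_seq (sortedP m3 L oo3 out3) _); last first.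
- move=> m4 [oo4 wr4]; exact: restP m4 _ oo4 wr4.
- by move=> m4 [oo4]; rewrite -catA; apply: post.
nia.
Qed.

Definition same_input m m' : Prop :=
  [/\ imem m' 0 0 = imem m 0 0, vmem m' 0 = vmem m 0 & vmem m' 1 = vmem m 1].

Lemma same_input_class m m' ph : same_input m m' ->
  [/\ class_job m' ph =1 class_job m ph, vmem m' ph = vmem m ph,
      gain m' ph =1 gain m ph & class_rest m' ph =1 class_rest m ph].
Proof.
move=> [n' v0 v1]; have vE (x : bool) : vmem m' x = vmem m x by case: x.
split=> // [j|Y|E].
- by rewrite /class_job /in_class n' v0 v1.
- by rewrite /gain !vE.
- by rewrite /class_rest /in_class n' v0 v1.
Qed.

Definition sufficient m ph Y : Prop :=
  [/\ initial (class_job m ph) (vmem m ph) Y, covers m ph Y & 0 <= gain m ph Y].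

Definition johnson_post m m' : Prop := exists EA EB,
  [/\ smallest (class_job m false) (vmem m 0) EA, covers m false EA,
      smallest (class_job m true) (vmem m 1) EB, covers m true EB &
      written m' (EA ++ class_rest m false EA ++
                  class_rest m true EB ++ rev EB)].

Lemma johnson_program_runs : exists c, forall m YA YB, (0 < imem m 0 0)%N ->
    imem m 0 3 = 0%N -> sufficient m false YA -> sufficient m true YB ->
  runs johnson_program m
    (c * (imem m 0 0 + ((size YA).+1 + (size YB).+1) *
                        (trunc_log 2 (imem m 0 0)).+2).+1)
    (johnson_post m).
Proof.
have [c0 runsA] := class_program_runs false.
have [c1 runsB] := class_program_runs true.
exists (c0 + c1 + 1)%N => m YA YB n_gt0 out0 [iA cA gA] [iB cB gB].
have wr0 : written m [::] by [].
set n := imem m 0 0.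
have run2 m1 : class_post false m [::] m1 -> runs (class_program true) m1
    (c1 * (n + (size YB).+1 * (trunc_log 2 n).+2).+1) (johnson_post m).
  move=> [n1 v0 v1 [EA [sA covA wr1]]].
  have io : same_input m m1 by [].
  have [jobE vE gainE restE] := same_input_class true io.
  rewrite -[n]n1; apply: runs_weaken (runsB m1 _ YB _ wr1 _ _ _) => //.
  - move=> m2 [_ _ _ [EB [sB covB wr2]]]; exists EA, EB; split=> //.
    + by apply: eq_smallest sB => [j|j _]; [exact: jobE | rewrite vE].
    + by move=> j; have := covB j; rewrite jobE gainE vE.
    + by move: wr2; rewrite restE cat0s -!catA.
  - by rewrite n1.
  - by apply: eq_initial iB => [j|j _]; [rewrite jobE | rewrite vE].
  - by move=> j; rewrite jobE gainE vE; apply: cB.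
  - by rewrite gainE.
apply: runs_weaken (runs_seq (runsA m [::] YA n_gt0 wr0 iA cA gA) run2) => //.
rewrite -/n; nia.
Qed.

End JohnsonProgram.

(** * From memory cells to jobs *)

Lemma lift_ords n (E : seq nat) :
  all (fun j => (j < n)%N) E -> exists e : seq 'I_n, E = map val e.
Proof.
elim: E => [|j E IH] /=; first by exists [::].
by move=> /andP[ltj /IH[e ->]]; exists (Ordinal ltj :: e).
Qed.

Section Instance.
Context {R : realFieldType} {n : nat}.
Variables q1 q2 : 'I_n -> R.
Hypotheses (q1_ge0 : forall j, 0 <= q1 j) (q2_ge0 : forall j, 0 <= q2 j).

(** What makes the extraction stop in time, stated for the set
    1, ..., k_A (X = A, f = p1, g = p2) or k_B, ..., n (X = B, f = p2, g = p1). *)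
Definition leading (X : {set 'I_n}) (f g : 'I_n -> R) (Y : seq 'I_n) : Prop :=
  initial (mem X) f Y /\ forall j, j \in X -> f j <= \sum_(i <- Y) (g i - f i).

Local Notation m := (input_memory q1 q2).

Definition key (ph : bool) := if ph then q2 else q1.
Definition class_set (ph : bool) := if ph then jobsB q1 q2 else jobsA q1 q2.
Definition rest ph (e : seq 'I_n) :=
  [seq j <- enum 'I_n | (j \in class_set ph) && (j \notin e)].

Lemma input_key (ph : bool) (j : 'I_n) : vmem m ph j = key ph j.
Proof. by case: ph => /=; rewrite valK. Qed.

Lemma input_class ph (j : 'I_n) : class_job m ph j = (j \in class_set ph).
Proof.
rewrite /class_job /= ltn_ord /in_class (input_key false) (input_key true) /class_set.
by case: ph; rewrite inE ?addbT ?addbF -?ltNge.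
Qed.

Lemma input_gain ph (y : seq 'I_n) :
  gain m ph (map val y) = \sum_(i <- y) (key (~~ ph) i - key ph i).
Proof. by rewrite /gain big_map; apply: eq_bigr => i _; rewrite !input_key. Qed.

Lemma input_class_lt ph j : class_job m ph j -> (j < n)%N.
Proof. by case/andP. Qed.

Lemma class_key_le ph j : j \in class_set ph -> key ph j <= key (~~ ph) j.
Proof. by case: ph => /=; rewrite inE // => /ltW. Qed.

Lemma sufficient_leading ph y :
  leading (class_set ph) (key ph) (key (~~ ph)) y -> sufficient m ph (map val y).
Proof.
move=> [[uy ay ry] cov]; split.
- split.
  + by rewrite (map_inj_uniq val_inj).
  + by rewrite all_map; apply: sub_all ay => j; rewrite /= input_class.
  + move=> _ j /mapP[i iy ->] Xj; have := Xj; rewrite -[j]/(val (Ordinal (input_class_lt Xj))).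
    rewrite input_class (mem_map val_inj) !input_key => Xj' nj; exact: ry.
- move=> j Xj; have := Xj; rewrite -[j]/(val (Ordinal (input_class_lt Xj))).
  rewrite input_class input_key input_gain.
  exact: cov.
- rewrite input_gain big_seq; apply: sumr_ge0 => i /(allP ay) /= Xi.
  by rewrite subr_ge0 class_key_le.
Qed.

Lemma input_rest ph e : class_rest m ph (map val e) = map val (rest ph e).
Proof.
rewrite /class_rest -[imem m 0 0]/n -val_enum_ord filter_map; congr map.
apply: eq_filter => j; rewrite /= (mem_map val_inj); congr (_ && _).
by rewrite -input_class /class_job ltn_ord.
Qed.

Lemma input_smallest ph e : smallest (class_job m ph) (vmem m ph) (map val e) ->
  smallest (mem (class_set ph)) (key ph) e.
Proof.
move=> [ue ae pe re]; split.
- by rewrite -(map_inj_uniq val_inj).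
- by move: ae; rewrite all_map; apply: sub_all => j; rewrite /= input_class.
- by move: pe; rewrite pairwise_map; apply: sub_pairwise => i j le_ij; rewrite -!input_key.
- move=> i j ie Xj nj; rewrite -!input_key; apply: re; rewrite ?(mem_map val_inj) //.
  by rewrite input_class.
Qed.

Lemma input_covers ph e j : covers m ph (map val e) -> j \in class_set ph ->
  key ph j + \sum_(i <- e) key ph i <= \sum_(i <- e) key (~~ ph) i.
Proof.
move=> cov; rewrite -input_class => /cov; rewrite input_key input_gain sumrB; lra.
Qed.

Lemma perm_class ph e : smallest (mem (class_set ph)) (key ph) e ->
  perm_eq (e ++ rest ph e) [seq j <- enum 'I_n | j \in class_set ph].
Proof.
move=> [ue /allP ae _ _]; apply: uniq_perm; rewrite ?(filter_uniq _ (enum_uniq _)) //.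
  rewrite cat_uniq ue (filter_uniq _ (enum_uniq _)) andbT.
  by apply/hasPn => j; rewrite mem_filter => /andP[/andP[]].
move=> j; rewrite mem_cat !(mem_filter _ j (enum 'I_n)) mem_enum !andbT.
by have [/ae|] := boolP (j \in e); rewrite ?andbT.
Qed.

Lemma class_lists_optimal eA eB :
    smallest (class_job m false) (vmem m 0) (map val eA) -> covers m false (map val eA) ->
    smallest (class_job m true) (vmem m 1) (map val eB) -> covers m true (map val eB) ->
  optimal_sequence q1 q2 (eA ++ rest false eA ++ rest true eB ++ rev eB).
Proof.
move=> /input_smallest sA cA /input_smallest sB cB.
have permA := perm_class sA; have permB := perm_class sB.
case: sA => _ aA pA rA; case: sB => _ aB pB rB.
apply: partly_sorted_optimal => //.
- rewrite catA.
  have permB' : perm_eq (rest true eB ++ rev eB)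
                        [seq j <- enum 'I_n | j \in jobsB q1 q2].
    by apply: perm_trans permB; rewrite perm_catC perm_cat2r perm_rev.
  apply: (perm_trans (perm_cat permA permB')); rewrite /class_set.
  rewrite [X in _ ++ X](eq_filter (a2 := predC [in jobsA q1 q2])).
    by rewrite perm_filterC.
  by move=> j; rewrite /= !inE ltNge.
- by move=> j; rewrite (perm_mem permA) mem_filter inE => /andP[].
- move=> j; rewrite mem_cat mem_rev orbC -mem_cat (perm_mem permB) mem_filter inE.
  by move=> /andP[/ltW].
- rewrite -sorted_pairwise; last by move=> j1 j2 j3 le21 le13; apply: le_trans le13 le21.
  rewrite rev_sorted sorted_pairwise //.
  by move=> ? ? ? /le_trans; apply.
- by move=> i j ie; rewrite mem_filter => /andP[/andP[Xj nj] _]; apply: rA.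
- by move=> i j; rewrite mem_rev mem_filter => ie /andP[/andP[Xj nj] _]; apply: rB.
- move=> j; rewrite mem_filter => /andP[/andP[Xj nj] _]; rewrite addrC.
  exact: (input_covers cA Xj).
- move=> j; rewrite mem_filter => /andP[/andP[Xj nj] _]; rewrite addrC !sum_rev.
  exact: (input_covers cB Xj).
Qed.

Lemma johnson_post_optimal m' : johnson_post m m' ->
  exists2 s : seq 'I_n, output n m' = map val s & optimal_sequence q1 q2 s.
Proof.
move=> [EA [EB [sA cA sB cB [_ out]]]].
have ltE ph E : smallest (class_job m ph) (vmem m ph) E ->
    exists e : seq 'I_n, E = map val e.
  by case=> _ aE _ _; apply: lift_ords; apply: sub_all aE => j; apply: input_class_lt.
have [eA EAE] := ltE false _ sA; have [eB EBE] := ltE true _ sB.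
subst EA EB; have opt := class_lists_optimal sA cA sB cB.
exists (eA ++ rest false eA ++ rest true eB ++ rev eB) => //.
move: out; rewrite !input_rest -map_rev -!map_cat size_map.
by have [/perm_size -> _ _] := opt; rewrite -cardE card_ord.
Qed.

End Instance.

Lemma johnson_program_solves (R : realFieldType) : exists c,
  forall n (q1 q2 : 'I_n -> R) yA yB,
    (forall j, 0 <= q1 j) -> (forall j, 0 <= q2 j) -> (0 < n)%N ->
    leading (jobsA q1 q2) q1 q2 yA -> leading (jobsB q1 q2) q2 q1 yB ->
  solves_within johnson_program q1 q2
    (c * (n + ((size yA).+1 + (size yB).+1) * (trunc_log 2 n).+2).+1).
Proof.
have [c prog] := @johnson_program_runs R.
exists c => n q1 q2 yA yB q1_ge0 q2_ge0 n_gt0 lA lB.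
have [t [m' [ex let_ /johnson_post_optimal[] // s out opt]]] :=
  prog (input_memory q1 q2) (map val yA) (map val yB) n_gt0 erefl
   (@sufficient_leading _ _ _ _ false _ lA) (@sufficient_leading _ _ _ _ true _ lB).
by rewrite !size_map in let_; exists t, m', s; split.
Qed.

(** * Johnson indices and the logarithmic condition *)

Lemma sqr_le_double_exp2 t : (t * t <= 2 * 2 ^ t)%N.
Proof.
elim: t => // t IH; rewrite expnS.
by case: t IH => [|[|[|t]]] // IH; move: IH; rewrite !expnS; nia.
Qed.

(** With t = log n: if K^2 <= n then (K t)^2 <= n * t^2 <= 2 n^2, since
    t^2 <= 2 * 2^t; if n < K^2 then t < 2 log K, so that K t is at most a
    constant times K log_b K. *)
Lemma mul_log_linear (R : realType) (b : R) : 1 < b -> exists c : nat,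
  forall n K, (0 < n)%N -> K%:R * logb b K%:R <= n%:R :> R ->
    (K * trunc_log 2 n <= c * n)%N.
Proof.
move=> b_gt1; have ln2 : 0 < ln (2%:R : R) by rewrite ln_gt0 // ltr1n.
have lnb : 0 < ln b by rewrite ln_gt0.
pose r := 2 * ln b / ln 2%:R; have r_ge0 : 0 <= r by rewrite divr_ge0 ?mulr_ge0 ?ltW.
exists (Num.bound r + 2)%N => n K n_gt0 leK; set t := trunc_log 2 n.
have [le_t lt_t] : (2 ^ t <= n)%N /\ (n < 2 ^ t.+1)%N.
  by split; [exact: trunc_logP | exact: trunc_log_ltn].
have [small|large] := leqP (K * K) n.
  have sq := sqr_le_double_exp2 t.
  have : ((K * t) ^ 2 <= (2 * n) ^ 2)%N by rewrite !expnS !expn0; nia.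
  by rewrite leq_exp2r // => /leq_trans; apply; rewrite leq_mul2r; lia.
have K_gt0 : (0 < K)%N by case: K large {leK}; lia.
have lnK : t%:R * ln 2%:R <= 2 * ln (K%:R : R).
  have -> : 2 * ln (K%:R : R) = ln ((K * K)%:R).
    by rewrite natrM lnM ?posrE ?ltr0n //; ring.
  rewrite mulr_natl -lnXn ?ltr0n // -natrX ler_ln ?posrE ?ltr0n ?expn_gt0 //.
    by rewrite ler_nat; lia.
  by rewrite muln_gt0 K_gt0.
have main : (K * t)%:R <= n%:R * r.
  rewrite /r mulrA ler_pdivlMr // natrM.
  move: leK; rewrite /logb mulrA ler_pdivrMr // => leK.
  have := ler_wpM2l (ler0n R K) lnK; lra.
rewrite -(ler_nat R); apply: (le_trans main); rewrite natrM mulrC.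
apply: ler_wpM2r => //; rewrite natrD.
have := archi_boundP r_ge0; lra.
Qed.

Section Indexed.
Context {R : realFieldType} {n : nat}.
Variables p1 p2 : 'I_n -> R.
Hypothesis indexed : johnson_indexed p1 p2.
Local Notation A := (jobsA p1 p2).
Local Notation B := (jobsB p1 p2).

Lemma indexed_mono :
  [/\ forall j : 'I_n, (j \in A) = (j < #|A|)%N,
      {in A &, forall i j : 'I_n, (i <= j)%N -> p1 i <= p1 j} &
      {in B &, forall i j : 'I_n, (i <= j)%N -> p2 j <= p2 i}].
Proof.
have [sA [sB [def_s permA permB sortA sortB]]] := indexed.
have szA : size sA = #|A| by rewrite (perm_size permA) -cardE.
have nthj (j : 'I_n) : nth j (sA ++ sB) j = j by rewrite -def_s nth_ord_enum.
have inA (j : 'I_n) : (j \in A) = (j < #|A|)%N.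
  have := nthj j; rewrite nth_cat szA; case: ltnP => [ltj eqj|gej eqj].
    by rewrite -mem_enum -(perm_mem permA) -[X in X \in _]eqj mem_nth ?szA.
  have ltj : (j - #|A| < size sB)%N.
    have := congr1 size def_s; rewrite size_cat szA size_enum_ord.
    by have := ltn_ord j; lia.
  have : j \in B by rewrite -mem_enum -(perm_mem permB) -[X in X \in _]eqj mem_nth.
  by rewrite !inE ltNge => /negPf.
have inB (j : 'I_n) : (j \in B) = ~~ (j < #|A|)%N by rewrite -inA !inE ltNge.
split=> // i j; rewrite ?inA ?inB => lti ltj leij.
  have ej := nthj j; have ei := nthj i; rewrite nth_cat szA lti in ei.
  rewrite nth_cat szA ltj (set_nth_default i) ?szA // in ej.
  rewrite -[X in p1 X <= _]ei -[X in _ <= p1 X]ej.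
  apply: (sorted_leq_nth _ _ i sortA); rewrite ?inE ?szA //.
  by move=> ? ? ? /le_trans; apply.
have size_sB : size sB = (n - #|A|)%N.
  by have := congr1 size def_s; rewrite size_cat szA size_enum_ord; lia.
have lti' : (i - #|A| < size sB)%N by rewrite size_sB; have := ltn_ord i; lia.
have ltj' : (j - #|A| < size sB)%N by rewrite size_sB; have := ltn_ord j; lia.
have ej := nthj j; have ei := nthj i.
rewrite nth_cat szA (negPf lti) in ei.
rewrite nth_cat szA (negPf ltj) (set_nth_default i) // in ej.
rewrite -[X in _ <= p2 X]ei -[X in p2 X <= _]ej.
apply: (sorted_leq_nth _ _ i sortB) => //; last by lia.
by move=> j1 j2 j3 le21 le13; apply: le_trans le13 le21.
Qed.

(** Since keys increase strictly when leaving K, both sums of the gap condition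
    at k range over K. *)
Lemma leading_gap (X K : {set 'I_n}) (f g : 'I_n -> R) k :
    (forall i, 0 <= f i) ->
    K \subset X -> (forall i, i \in K -> f i <= f k) ->
    (forall i, i \in X -> i \notin K -> f k < f i) -> gap_at X f g k ->
  leading X f g (enum K) /\
  forall j, j \in X -> \sum_(i in K) f i + f j <= \sum_(i in K) g i.
Proof.
move=> f_ge0 /subsetP subKX leK gtK.
have KE i : (i \in X) && (f i <= f k) = (i \in K).
  apply/andP/idP => [[iX lei]|iK]; last by rewrite subKX ?leK.
  by apply: contraLR lei => iK; rewrite -ltNge gtK.
rewrite /gap_at !(eq_bigl _ _ KE) => gap.
have le_max j : j \in X -> f j <= pmax X f by move=> jX; apply: (le_bigmax_cond _ f jX).
have cov j : j \in X -> \sum_(i in K) f i + f j <= \sum_(i in K) g i.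
  by move/le_max => /=; move: gap => /=; lra.
split=> //; split.
  split; first exact: enum_uniq.
    by apply/allP => i; rewrite mem_enum; apply: subKX.
  move=> y j; rewrite !mem_enum => yK jX jK.
  exact: le_lt_trans (leK y yK) (gtK j jX jK).
by move=> j /cov; rewrite big_enum /= sumrB; lra.
Qed.

Hypotheses (p1_ge0 : forall j, 0 <= p1 j) (p2_ge0 : forall j, 0 <= p2 j).

Lemma kA_leading (k : 'I_n) (K := [set j : 'I_n | (j <= k)%N]) :
    kA_condition p1 p2 k ->
  [/\ K \subset A, leading A p1 p2 (enum K) &
  forall j, j \in A -> \sum_(i in K) p1 i + p1 j <= \sum_(i in K) p2 i].
Proof.
have [inA monoA _] := indexed_mono.
case=> kA gap strict.
have sub : K \subset A.
  apply/subsetP => i iK; rewrite inA; move: iK kA; rewrite inE inA.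
  exact: leq_ltn_trans.
have [||lead cov] := @leading_gap A K p1 p2 k p1_ge0 sub _ _ gap; last by split.
- by move=> i iK; apply: monoA => //; [exact: (subsetP sub) | rewrite inE in iK].
- move=> i iA; rewrite inE -ltnNge => ltki.
  have ltk1 : (k.+1 < n)%N by apply: leq_ltn_trans ltki (ltn_ord i).
  have k1A : Ordinal ltk1 \in A.
    by rewrite inA /=; apply: leq_ltn_trans ltki _; rewrite -inA.
  exact: lt_le_trans (strict _ k1A erefl) (monoA _ _ k1A iA ltki).
Qed.

Lemma kB_leading (k : 'I_n) (K := [set j : 'I_n | (k <= j)%N]) :
    kB_condition p1 p2 k ->
  [/\ K \subset B, leading B p2 p1 (enum K) &
  forall j, j \in B -> \sum_(i in K) p2 i + p2 j <= \sum_(i in K) p1 i].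
Proof.
have [inA _ monoB] := indexed_mono.
have inB (j : 'I_n) : (j \in B) = (#|A| <= j)%N by rewrite leqNgt -inA !inE ltNge.
case=> kB gap strict.
have sub : K \subset B.
  apply/subsetP => i iK; rewrite inB; move: iK kB; rewrite inE inB => leki lek.
  exact: leq_trans lek leki.
have [||lead cov] := @leading_gap B K p2 p1 k p2_ge0 sub _ _ gap; last by split.
- by move=> i iK; apply: monoB => //; [exact: (subsetP sub) | rewrite inE in iK].
- move=> i iB; rewrite inE -ltnNge => ltik.
  have ltk1 : (k.-1 < n)%N by have := ltn_ord k; lia.
  have k1B : Ordinal ltk1 \in B.
    by move: iB; rewrite !inB /=; lia.
  have lei1 : (i <= Ordinal ltk1)%N by rewrite /=; lia.
  apply: lt_le_trans (strict _ k1B _) (monoB _ _ iB k1B lei1).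
  by rewrite /=; lia.
Qed.

End Indexed.

(** * The two claims together *)

Lemma leading_perm (R : realFieldType) n (X X' : {set 'I_n}) (f g : 'I_n -> R) Y
    (pi : {perm 'I_n}) : (forall j, (j \in X') = (pi j \in X)) ->
  leading X f g Y ->
  leading X' (fun j => f (pi j)) (fun j => g (pi j)) [seq (pi^-1)%g j | j <- Y].
Proof.
move=> XE [[uY aY rY] cov].
have memY j : (j \in [seq (pi^-1)%g j | j <- Y]) = (pi j \in Y).
  by rewrite -[j in LHS](permK pi) (mem_map perm_inj).
split; last first.
  move=> j; rewrite XE big_map => /cov /le_trans; apply.
  by under [leRHS]eq_bigr => i _ do rewrite permKV.
split; first by rewrite (map_inj_uniq perm_inj).
  by rewrite all_map; apply: sub_all aY => j /= jX; rewrite XE permKV.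
by move=> y j; rewrite !memY /= XE; apply: rY.
Qed.

Lemma filter_enum_set n (P : pred 'I_n) :
  [seq j <- enum 'I_n | P j] = enum [set j | P j].
Proof. by rewrite enumT; apply: eq_filter => j; rewrite /= inE. Qed.

Lemma card_ord_range n (K : {set 'I_n}) lo hi :
  {in K, forall j : 'I_n, (lo <= j < hi)%N} -> (#|K| <= hi - lo)%N.
Proof.
move=> inK; rewrite cardE -(size_map val) -(size_iota lo (hi - lo)).
apply: uniq_leq_size; first by rewrite (map_inj_uniq val_inj) enum_uniq.
move=> _ /mapP[j jK ->]; have := inK j; rewrite -mem_enum => /(_ jK).
by rewrite mem_iota /=; lia.
Qed.

Lemma enum_set_pairwise n (K : {set 'I_n}) (r : rel 'I_n) :
    {in K &, forall i j : 'I_n, (i <= j)%N -> r i j} -> pairwise r (enum K).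
Proof.
move=> rK; have inc : pairwise (fun i j : 'I_n => (i < j)%N) (enum K).
  apply: pairwise_filter; rewrite -enumT.
  rewrite -(pairwise_map val ltn) val_enum_ord -sorted_pairwise; last exact: ltn_trans.
  exact: iota_ltn_sorted.
have aK : all (mem K) (enum K) by apply/allP => j; rewrite mem_enum.
by apply: (sub_in_pairwise _ aK inc) => i j iK jK /ltnW; apply: rK.
Qed.

Theorem mainTheorem3 (R : realType) (b : R) (hb : 1 < b) :
  exists (P : program) (c : nat),
  forall (n : nat) (p1 p2 : 'I_n -> R) (kA kB : 'I_n),
    let A := jobsA p1 p2 in
    let B := jobsB p1 p2 in
    let nA := #|A| in
    (forall j, 0 <= p1 j) ->
    (forall j, 0 <= p2 j) ->
    johnson_indexed p1 p2 ->
    A != set0 ->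
    B != set0 ->
    \sum_(i in A) p1 i <= \sum_(i in A) p2 i - pmax A p1 ->
    \sum_(i in B) p2 i <= \sum_(i in B) p1 i - pmax B p2 ->
    is_kA p1 p2 kA ->
    is_kB p1 p2 kB ->
    (* in the numbering 1, ..., n, the indices are kA + 1 and kB + 1 *)
    kA.+1%:R * logb b kA.+1%:R <= n%:R ->
    (n - kB)%N%:R * logb b (n - kB)%N%:R <= n%:R ->
    (* the algorithm receives the jobs in an arbitrary order *)
    (forall pi : {perm 'I_n},
       solves_within P (fun j => p1 (pi j)) (fun j => p2 (pi j)) (c * n)%N) /\
    (forall u v : seq 'I_n,
       perm_eq u [seq j : 'I_n <- enum 'I_n | (kA < j < nA)%N] ->
       perm_eq v [seq j : 'I_n <- enum 'I_n | (nA <= j < kB)%N] ->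
       optimal_sequence p1 p2
         ([seq j : 'I_n <- enum 'I_n | (j <= kA)%N] ++ u ++ v ++
          [seq j : 'I_n <- enum 'I_n | (kB <= j)%N])).
Proof.
have [c1 logP] := mul_log_linear hb.
have [c0 prog] := @johnson_program_solves R.
(* With K jobs in a sorted part, K <= n, t = log n < n and K t <= c1 n, the
   running time n + (KA + KB + 2) (t + 2) + 1 is at most (2 c1 + 12) n. *)
exists johnson_program, (c0 * (2 * c1 + 12))%N.
move=> n p1 p2 kA kB A B nA p1_ge0 p2_ge0 indexed _ _ _ _ [kAP _] [kBP _] logA logB.
have [inA monoA monoB] := indexed_mono indexed.
have inB (j : 'I_n) : (j \in B) = (nA <= j)%N by rewrite leqNgt -inA !inE ltNge.
have [subA leadA covA] := kA_leading indexed p1_ge0 kAP.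
have [subB leadB covB] := kB_leading indexed p2_ge0 kBP.
have n_gt0 : (0 < n)%N by have := ltn_ord kA; lia.
split=> [pi|u v perm_u perm_v].
  have classA (j : 'I_n) : (j \in jobsA (fun j => p1 (pi j)) (fun j => p2 (pi j)))
                           = (pi j \in A) by rewrite !inE.
  have classB (j : 'I_n) : (j \in jobsB (fun j => p1 (pi j)) (fun j => p2 (pi j)))
                           = (pi j \in B) by rewrite !inE.
  have := prog n _ _ _ _ (fun j => p1_ge0 (pi j)) (fun j => p2_ge0 (pi j)) n_gt0
    (leading_perm classA leadA) (leading_perm classB leadB).
  case=> t [m [s [ex let_ out opt]]]; exists t, m, s; split=> //.
  apply: leq_trans let_ _; rewrite !size_map -!cardE.
  have : (#|[set j : 'I_n | (j <= kA)%N]| <= kA.+1)%N.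
    by rewrite -[leqRHS]subn0; apply: card_ord_range => j; rewrite inE ltnS.
  have : (#|[set j : 'I_n | (kB <= j)%N]| <= n - kB)%N.
    by apply: card_ord_range => j; rewrite inE ltn_ord => ->.
  move: #|_| #|_| => sB sA leB leA; have := logP n _ n_gt0 logA; have := logP n _ n_gt0 logB.
  have := ltn_ord kA; have := ltn_ord kB.
  have : (trunc_log 2 n < n)%N by apply: leq_trans (trunc_logP (isT : 1 < 2)%N n_gt0); apply: ltn_expl.
  set t' := trunc_log 2 n => ltt ltB ltA bB bA.
  rewrite -mulnA leq_mul2l; apply/orP; right; nia.
rewrite !filter_enum_set in perm_u perm_v *.
have kA_lt : (kA < nA)%N by case: kAP; rewrite inA.
have kB_ge : (nA <= kB)%N by case: kBP; rewrite inB.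
apply: partly_sorted_optimal => //.
- apply: uniq_perm; rewrite ?enum_uniq //.
    rewrite !cat_uniq (perm_uniq perm_u) (perm_uniq perm_v) !enum_uniq /= !andbT.
    apply/and3P; split; apply/hasPn => j; rewrite ?mem_cat ?(perm_mem perm_u)
      ?(perm_mem perm_v) !mem_enum !inE; lia.
  move=> j; rewrite !mem_cat (perm_mem perm_u) (perm_mem perm_v) !mem_enum !inE.
  lia.
- move=> j; rewrite mem_cat (perm_mem perm_u) !mem_enum => jA.
  have : j \in A by move: jA; rewrite inA !inE -/nA; lia.
  by rewrite inE.
- move=> j; rewrite mem_cat (perm_mem perm_v) !mem_enum => jB.
  have : j \in B by move: jB; rewrite inB !inE; lia.
  by rewrite inE => /ltW.
- apply: enum_set_pairwise => i j /(subsetP subA) iA /(subsetP subA) jA.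
  exact: monoA.
- apply: enum_set_pairwise => i j /(subsetP subB) iB /(subsetP subB) jB.
  exact: monoB.
- move=> i j; rewrite (perm_mem perm_u) !mem_enum => iK.
  rewrite inE => /andP[gtj ltj]; apply: monoA; first exact: (subsetP subA).
    by rewrite inA.
  by move: iK; rewrite inE => /leq_trans; apply; apply: ltnW.
- move=> i j; rewrite (perm_mem perm_v) !mem_enum => iK.
  rewrite inE => /andP[gej ltj]; apply: monoB; first 1 last.
  + exact: (subsetP subB).
  + by move: iK; rewrite inE; apply: leq_trans; apply: ltnW.
  by rewrite inB.
- move=> j; rewrite (perm_mem perm_u) mem_enum inE => /andP[_ ltj].
  by rewrite !big_enum; apply: covA; rewrite inA.
- move=> j; rewrite (perm_mem perm_v) mem_enum inE => /andP[gej _].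
  by rewrite !big_enum; apply: covB; rewrite inB.
Qed.
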